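(* Let $\Omega$, $a$, $f$ be as in the context. Assume that $a\in C^1(\Omega)$ with $\frac{\partial a}{\partial s}>0$ on $\Omega$, that $a_+:[0,1]\to[0,\infty]$ is continuous, and that there are constants $\bar a,\tilde a>0$ with $|a(u,s)|\le\bar a|s|+\tilde a$ for all $u\in[0,1]$, $s\in\mathbb R$ (in particular $\Omega=[0,1]\times\mathbb R$). Let $\sigma\in[\sigma_s,\sigma_r]$ be such that $\mathcal S_\sigma$ is a nonempty finite set. Then the function $u_\sigma$ defined on $\mathbb R\setminus\mathcal S_\sigma$ by $\mathcal G_\sigma(u_\sigma(\xi))=\xi$ is a flux-saturated solution (flux-saturated profile, with exceptional set $\mathcal S_\sigma$) of $(a(u,u'))'-\sigma u'+f(u)=0$.
   Context: $\Omega=\{(u,s)\in\mathbb R^2: u\in[0,1],\ \omega_-(u)<s<\omega_+(u)\}$, where $\omega_+:[0,1]\to(0,\infty]$ is lower semicontinuous and $\omega_-=-\omega_+$. The flux $a:\Omega\to\mathbb R$ is continuous, $a(u,-s)=-a(u,s)$, and $s\mapsto a(u,s)$ is increasing for every $u$. Put $a_\pm(u)=\lim_{s\to\omega_\pm(u)}a(u,s)$; it is assumed that $a_+(u)=\infty$ whenever $\omega_+(u)<\infty$. The reaction term satisfies $f\in C^1[0,1]$, $f(0)=f(1)=0$, $f>0$ on $(0,1)$. Let $\mathcal D=\{(u,v)\in[0,1]\times\mathbb R: a_-(u)<v<a_+(u)\}$ and let $g:\mathcal D\to\mathbb R$ be defined by $a(u,g(u,v))=v$. For $\sigma\ge0$,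 $(\alpha_\sigma,1]$ ($\alpha_\sigma\in[0,1)$) is the maximal interval to the left of $1$ on which there is a (unique) $V_\sigma\in C((\alpha_\sigma,1])\cap C^1((\alpha_\sigma,1))$ with $V_\sigma(1)=0$, $0<V_\sigma<a_+$ and $\dot V_\sigma=\sigma-\frac{f(u)}{g(u,V_\sigma)}$ on $(\alpha_\sigma,1)$; if $\alpha_\sigma=0$, $V_\sigma(0)=\lim_{u\to0^+}V_\sigma(u)$. $\sigma_r=\inf\{\sigma>0:\alpha_\sigma=0,\ V_\sigma(0)=0\}$. Let $\mathcal H(u,V)=\frac1{g(u,V)}$ if $0<V<a_+(u)$ and $\mathcal H(u,V)=0$ if $V\ge a_+(u)$. For $\sigma\ge0$, $\mathcal V_\sigma\in C([0,1])\cap C^1((0,1))$ is the unique function, positive on $(0,1)$, with $\dot{\mathcal V}_\sigma=\sigma-f(u)\mathcal H(u,\mathcal V_\sigma)$ on $(0,1)$, $\mathcal V_\sigma(1)=0$. $\sigma_s=\min\{\sigma\ge0:\mathcal V_\sigma(0)=0\}$. Fix $u_0\in(0,1)$ and, for $\sigma\ge\sigma_s$, let $\mathcal G_\sigma(u)=\int_{u_0}^u\mathcal H(\delta,\mathcal V_\sigma(\delta))\,d\delta$, $u\in(0,1)$; this is a nondecreasing $C^1$ function with limits $-\infty$ at $0$ and $+\infty$ at $1$. Its set of critical levels is $\mathcal S_\sigma=\{\xi\in\mathbb R:\exists u\in(0,1),\ \mathcal G_\sigma(u)=\xi,\ \dot{\mathcal G}_\sigma(u)=0\}$. For $u$ of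 bounded variation on $\mathbb R$ (finite total variation), $u'_{rn}$ denotes the density of the absolutely continuous part of the distributional derivative $Du$. A function $u:\mathbb R\to[0,1]$ of bounded variation is a distributional solution of $(a(u,u'))'-\sigma u'+f(u)=0$ if $\int_{\mathbb R}[a(u,u'_{rn})-\sigma u]\varphi'\,d\xi=\int_{\mathbb R}f(u)\varphi\,d\xi$ for all test functions $\varphi\in C_c^\infty(\mathbb R)$. If $u\in C^1(\mathbb R\setminus\mathcal S)$ with $\mathcal S$ finite, a point $\hat\xi\in\mathcal S$ is saturated if $\lim_{\xi\to\hat\xi}u'(\xi)=+\infty$ and $\lim_{\xi\to\hat\xi^-}u(\xi)\le\lim_{\xi\to\hat\xi^+}u(\xi)$. Such a $u$ is a flux-saturated profile (solution), with exceptional set $\mathcal S$, if it is a distributional solution and all points of $\mathcal S$ are saturated. *)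

(* Defs.v *)
From HB Require Import structures.
From mathcomp Require Import all_boot all_order all_algebra.
From mathcomp Require Import all_classical all_reals all_analysis.

Set Implicit Arguments.
Unset Strict Implicit.
Unset Printing Implicit Defensive.

Import Order.TTheory GRing.Theory Num.Theory.
Import numFieldNormedType.Exports.

Local Open Scope classical_set_scope.
Local Open Scope ring_scope.

Section Regularity.
Context {R : realType}.
Implicit Types (f : R -> R) (A : set R).

Definition C1_at f (x : R) : Prop :=
  (\forall y \near x, derivable f y 1) /\ {for x, continuous (derive1 f)}.

(* C^1 up to the end points: the derivative on the open interval extends
   continuously to the closed one. *)
Definition C1_closed (x y : R) f : Prop :=
  {within `[x, y], continuous f} /\
  exists df : R -> R, {within `[x, y], continuous df} /\
    forall z, z \in `]x, y[ -> is_derive z 1 f (df z).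

Definition is_minimum A (m : R) : Prop := A m /\ lbound A m.

Definition test_function f : Prop :=
  (forall (n : nat) (x : R), derivable (derive1n n f) x 1) /\
  exists M : R, forall x, M < `|x| -> f x = 0.

Definition oriented_integral f (x y : R) : R :=
  if x <= y then \int[lebesgue_measure]_(t in `[x, y]) f t
  else - \int[lebesgue_measure]_(t in `[y, x]) f t.

Definition bounded_variation_line f : Prop :=
  exists M : R, forall x y, x <= y -> (total_variation x y f <= M%:E)%E.

(* h is the density of the absolutely continuous part of the distributional
   derivative of f.  Its singular part is the difference nu1 - nu2 of two finite
   measures carried by the Lebesgue-null set N, so the display in the last clause
   is the Lebesgue decomposition of the finite signed measure Df. *)
Definition ac_density f (h : R -> R) : Prop :=
  lebesgue_measure.-integrable [set: R] (EFin \o h) /\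
  exists (nu1 nu2 : {finite_measure set R -> \bar R}) (N : set R),
    [/\ measurable N, lebesgue_measure N = 0%E,
        nu1 (~` N) = 0%E, nu2 (~` N) = 0%E &
        forall phi, test_function phi ->
          \int[lebesgue_measure]_x (f x * derive1 phi x) =
          - (\int[lebesgue_measure]_x (phi x * h x)
             + \int[nu1]_x phi x - \int[nu2]_x phi x)].

End Regularity.

Section Flux.
Context {R : realType}.
(* omega is omega_+ : [0, 1] -> (0, oo]; omega_- is - omega_+.  The values of
   omega off [0, 1] and of a off Omega are irrelevant. *)
Variables (omega : R -> \bar R) (a : R -> R -> R).

Definition Omega : set (R * R) :=
  [set p | 0 <= p.1 <= 1 /\ (- omega p.1 < p.2%:E < omega p.1)%E].

Definition aplus (u : R) : \bar R :=
  match omega u with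
  | r%:E => lim ((a u s)%:E @[s --> r^'-])
  | _ => lim ((a u s)%:E @[s --> +oo])
  end.

Definition aminus (u : R) : \bar R :=
  match omega u with
  | r%:E => lim ((a u s)%:E @[s --> (- r)^'+])
  | _ => lim ((a u s)%:E @[s --> -oo])
  end.

Definition flux_domain : Prop :=
  (forall u, 0 <= u <= 1 -> (0 < omega u)%E) /\
  lower_semicontinuous (omega : subspace `[0, 1]%classic -> \bar R).

Definition flux : Prop :=
  [/\ {within Omega, continuous (fun p : R * R => a p.1 p.2)},
      forall u s, Omega (u, s) -> a u (- s) = - a u s,
      forall u s t, Omega (u, s) -> Omega (u, t) -> s < t -> a u s < a u t &
      forall u, 0 <= u <= 1 -> (omega u < +oo)%E -> aplus u = +oo%E].

(* a is C^1 on Omega, which contains the segments over u = 0 and u = 1 but is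
   open in the s-direction: the partial derivatives are continuous up to
   these segments. *)
Definition flux_C1 : Prop :=
  exists au as_ : R * R -> R,
    [/\ {within Omega, continuous au}, {within Omega, continuous as_},
        forall u s, Omega (u, s) -> 0 < u < 1 ->
          is_derive u 1 (a ^~ s) (au (u, s)) &
        forall u s, Omega (u, s) -> is_derive s 1 (a u) (as_ (u, s))].

Definition calD : set (R * R) :=
  [set p | 0 <= p.1 <= 1 /\ (aminus p.1 < p.2%:E < aplus p.1)%E].

(* On calD, the unique s with a u s = v. *)
Definition g (u v : R) : R :=
  xget 0 [set s | [/\ calD (u, v), Omega (u, s) & a u s = v]].

(* The reciprocal of g only makes sense for v > 0; calH is evaluated only there. *)
Definition calH (u v : R) : R :=
  if (v%:E < aplus u)%E then (g u v)^-1 else 0.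

Variable f : R -> R.

Definition reaction : Prop :=
  [/\ C1_closed 0 1 f, f 0 = 0, f 1 = 0 & forall u, 0 < u < 1 -> 0 < f u].

Definition solves_V (sigma alpha : R) (V : R -> R) : Prop :=
  [/\ 0 <= alpha < 1,
      {within `]alpha, 1]%classic, continuous V},
      V 1 = 0 &
      forall u, alpha < u < 1 ->
        [/\ C1_at V u, 0 < V u, ((V u)%:E < aplus u)%E &
            derive1 V u = sigma - f u / g u (V u)]].

(* alpha is alpha_sigma and V is V_sigma. *)
Definition is_V (sigma alpha : R) (V : R -> R) : Prop :=
  solves_V sigma alpha V /\
  forall beta W, solves_V sigma beta W -> alpha <= beta.

(* The infimum is +oo when no speed is admissible. *)
Definition sigma_r : \bar R :=
  ereal_inf [set s%:E | s in
    [set s : R | 0 < s /\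
       exists V : R -> R, is_V s 0 V /\ V u @[u --> 0^'+] --> (0 : R)]].

Definition is_calV (sigma : R) (V : R -> R) : Prop :=
  [/\ {within `[0, 1], continuous V},
      V 1 = 0 &
      forall u, 0 < u < 1 ->
        [/\ C1_at V u, 0 < V u & derive1 V u = sigma - f u * calH u (V u)]].

Definition is_sigma_s (sigma_s : R) : Prop :=
  is_minimum [set s : R | 0 <= s /\
                exists V : R -> R, is_calV s V /\ V 0 = 0] sigma_s.

Variable V : R -> R.

Definition calG (u0 u : R) : R :=
  oriented_integral (fun d => calH d (V d)) u0 u.

Definition critical_levels (u0 : R) : set R :=
  [set xi | exists u : R,
     [/\ 0 < u < 1, calG u0 u = xi & is_derive u 1 (calG u0) 0]].

(* Off the critical levels this is the unique u in (0, 1) with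
   calG u0 u = xi; at the finitely many critical levels the value is an
   arbitrary point of the level set. *)
Definition profile (u0 xi : R) : R :=
  xget 0 [set u | 0 < u < 1 /\ calG u0 u = xi].

End Flux.

Section Profiles.
Context {R : realType}.
Variables (omega : R -> \bar R) (a : R -> R -> R) (f : R -> R) (sigma : R).
Implicit Types (u : R -> R) (S : set R).

(* h is u'_rn; integrability is what gives a meaning to the integrals. *)
Definition distributional_solution u : Prop :=
  [/\ forall xi, 0 <= u xi <= 1,
      bounded_variation_line u &
      exists h : R -> R,
        [/\ ac_density u h,
            {ae lebesgue_measure, forall xi, Omega omega (u xi, h xi)} &
            forall phi, test_function phi ->
              [/\ lebesgue_measure.-integrable [set: R]
                    (fun xi => ((a (u xi) (h xi) - sigma * u xi)
                                * derive1 phi xi)%:E),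
                  lebesgue_measure.-integrable [set: R]
                    (fun xi => (f (u xi) * phi xi)%:E) &
                  \int[lebesgue_measure]_xi
                    ((a (u xi) (h xi) - sigma * u xi) * derive1 phi xi) =
                  \int[lebesgue_measure]_xi (f (u xi) * phi xi)]]].

Definition saturated u (xi : R) : Prop :=
  derive1 u x @[x --> xi^'] --> +oo /\
  exists l r : R,
    [/\ u x @[x --> xi^'-] --> l, u x @[x --> xi^'+] --> r & l <= r].

Definition flux_saturated_profile u S : Prop :=
  [/\ finite_set S, forall xi, ~ S xi -> C1_at u xi,
      distributional_solution u & forall xi, S xi -> saturated u xi].

End Profiles.

(* Main.v *)
Require Import Defs.
From mathcomp Require Import all_boot all_order all_algebra.
From mathcomp Require Import all_classical all_reals all_analysis.
From HB Require Import structures.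
From mathcomp Require Import measurable_realfun ring lra.
Import Order.TTheory GRing.Theory Num.Theory.
Import numFieldNormedType.Exports.
Local Open Scope classical_set_scope.
Local Open Scope ring_scope.

Set Implicit Arguments.
Unset Strict Implicit.
Unset Printing Implicit Defensive.

(** Write p(y) = H(y, V(y)), a continuous nonnegative function on ]0, 1[, and let
    G be its primitive and u a right inverse of G.  Linear growth of the flux
    forces omega = +oo, and the bound a(u, s) >= m s for small s near u = 0 and
    u = 1 makes G diverge at both ends, so that u is defined on all of R.
    The image of p(y) dy under G is the Lebesgue measure, so every integral over
    R in the weak formulation becomes an integral over ]0, 1[ in the variable
    y = u(xi), where the profile is the identity and has no jump, phi o G is C^1
    and compactly supported, and an ordinary integration by parts applies.
    The zeros of p are mapped by G onto the finitely many critical levels: they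
    carry the singular part of Du, and elsewhere u' = 1 / p(u). *)

(** [G] is nondecreasing but may be flat: a critical level is reached at a single point, where [u]
    gets a vertical tangent, or along an interval, which [u] jumps over. There [u] is an arbitrary
    choice in the level set, and [u (G y) = y] is guaranteed only where [p y] is nonzero. Hence
    identities in the variable y are only used after multiplication by [p y], which removes every
    dependence on the choice. Divergence of [G] rests on [H >= m / V] for small [V], so [V] has to
    be bounded linearly by the distance to each end. At 0 this comes from [V 0 = 0], where
    [sigma >= sigma_s] enters through a comparison of solutions: then [V y <= sigma * y]. At 1 the
    equation gives no such bound directly; but if [G] were bounded, [f y <= C * (1 - y)] would force
    [V y <= K * (1 - y)], and then [G] would diverge logarithmically after all. *)

Section density.
Local Open Scope ereal_scope.
Context d (T : measurableType d) (R : realType).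
Import HBNNSimple.

(** Monotone convergence along simple functions on both sides reduces the claim to level sets, where
    it is [nuE]. *)
Lemma ge0_integral_density (mu nu : {measure set T -> \bar R}) (p : T -> R) :
  measurable_fun [set: T] p -> (forall x, 0 <= p x)%R ->
  (forall A, measurable A -> nu A = \int[mu]_(x in A) (p x)%:E) ->
  forall k : T -> \bar R, measurable_fun [set: T] k -> (forall x, 0 <= k x) ->
  \int[nu]_x k x = \int[mu]_x (k x * (p x)%:E).
Proof.
move=> mp p0 nuE k mk k0.
pose h := nnsfun_approx measurableT mk.
have hk x : (EFin \o h n) x @[n --> \oo] --> k x by exact: cvg_nnsfun_approx.
have h0 n x : (0 <= h n x)%R by exact: fun_ge0.
have mh n : measurable_fun setT (EFin \o h n).
  by apply/measurable_EFinP; exact/measurable_funP.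
have mpE : measurable_fun setT (EFin \o p) by exact/measurable_EFinP.
have hnd m n : (m <= n)%N -> forall x, (h m x <= h n x)%R.
  by move=> mn x; exact/lefP/nd_nnsfun_approx.
transitivity (limn (fun n => \int[nu]_x (h n x)%:E)).
  rewrite -monotone_convergence//.
  - by apply: eq_integral => x _; apply/esym/cvg_lim => //; exact: hk.
  - by move=> n x _; rewrite lee_fin.
  - by move=> x _ m n mn; rewrite lee_fin; exact: hnd.
transitivity (limn (fun n => \int[mu]_x ((h n x)%:E * (p x)%:E))); last first.
  rewrite -monotone_convergence//.
  - apply: eq_integral => x _; apply/cvg_lim => //.
    by apply: cvgeZr => //; exact: hk.
  - by move=> n; apply: emeasurable_funM; [exact: mh|].
  - by move=> n x _; rewrite mule_ge0 ?lee_fin.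
  - by move=> x _ m n mn; rewrite lee_wpmul2r ?lee_fin//; exact: hnd.
congr (limn _); apply/funext => n.
have mhr r : measurable (h n @^-1` [set r]) by [].
have hE x : (h n x * p x)%:E =
    \sum_(r \in range (h n)) (r * \1_(h n @^-1` [set r]) x * p x)%:E.
  rewrite (fimfunE _ x) fsbig_finite//= big_distrl/= -sumEFin fsbig_finite//=.
rewrite integralT_nnsfun sintegralE.
under [RHS]eq_integral => x _ do rewrite -EFinM hE.
rewrite ge0_integral_fsum//; last 2 first.
- move=> r; apply/measurable_EFinP; apply: measurable_funM => //.
  by apply: measurable_funM.
- move=> r x _; rewrite lee_fin mulr_ge0// indicE.
  by case: (boolP (_ \in _)) => [|_]; rewrite ?mulr0 ?mulr1// inE/= => <-.
apply: eq_fsbigr => r; rewrite inE => -[x0 _ rE].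
rewrite nuE//; under [RHS]eq_integral => x _ do rewrite -mulrA EFinM.
rewrite ge0_integralZl//; last 3 first.
- by apply/measurable_EFinP; apply: measurable_funM.
- by move=> x _; rewrite lee_fin mulr_ge0.
- by rewrite lee_fin -rE.
congr (_ * _); rewrite integral_mkcond; apply: eq_integral => x _.
by rewrite patchE indicE; case: (boolP (_ \in _)) => _; rewrite ?mul1r ?mul0r.
Qed.

End density.

(** The two proofs are arguments so that the measure structure declared below can be inferred from
    the term itself. *)
Definition density_measure d (T : measurableType d) (R : realType)
    (mu : {measure set T -> \bar R}) (p : T -> R)
    of measurable_fun [set: T] p & (forall x, 0 <= p x) :=
  fun A : set T => (\int[mu]_(x in A) (p x)%:E)%E.

Section density_measure.
Local Open Scope ereal_scope.
Context d (T : measurableType d) (R : realType).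
Variables (mu : {measure set T -> \bar R}) (p : T -> R).
Hypotheses (mp : measurable_fun [set: T] p) (p0 : (forall x, 0 <= p x)%R).

Local Notation nu := (density_measure mu mp p0).

Let nu0 : nu set0 = 0. Proof. exact: integral_set0. Qed.

Let nu_ge0 A : 0 <= nu A.
Proof. by apply: integral_ge0 => x _; rewrite lee_fin. Qed.

Let nu_sigma_additive : semi_sigma_additive nu.
Proof.
move=> F mF tF mUF; rewrite /density_measure ge0_integral_bigcup//.
- by apply: is_cvg_ereal_nneg_natsum => n _; exact: nu_ge0.
- by apply/measurable_EFinP/measurable_funTS.
- by move=> x _; rewrite lee_fin.
Qed.

HB.instance Definition _ := isMeasure.Build _ _ _ nu nu0 nu_ge0 nu_sigma_additive.

(** Since [p >= 0], multiplication by [p] commutes with positive and negative parts, so the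
    nonnegative case yields every measurable [k], integrable or not. *)
Lemma integral_pushforward_density d' (U : measurableType d') (G : T -> U)
    (k : U -> \bar R) :
  measurable_fun [set: T] G -> measurable_fun [set: U] k ->
  \int[pushforward nu G]_x k x = \int[mu]_x (k (G x) * (p x)%:E).
Proof.
move=> mG mk.
have H k' : measurable_fun [set: U] k' -> (forall x, 0 <= k' x) ->
    \int[pushforward nu G]_x k' x = \int[mu]_x (k' (G x) * (p x)%:E).
  move=> mk' k'0; rewrite (@ge0_integral_pushforward _ _ _ _ _ _ mG nu)//.
  rewrite preimage_setT (@ge0_integral_density _ _ _ mu nu p mp p0)//.
    exact: measurableT_comp.
  by move=> x; exact: k'0.
rewrite [LHS]integralE H; last 2 first.
- exact: measurable_funepos.
- by move=> x; exact: funepos_ge0.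
rewrite H; last 2 first.
- exact: measurable_funeneg.
- by move=> x; exact: funeneg_ge0.
rewrite [RHS]integralE; congr (_ - _); apply: eq_integral => x _.
- by rewrite !funeposE maxe_pMl ?lee_fin// mul0e.
- by rewrite !funenegE -mulNe maxe_pMl ?lee_fin// mul0e.
Qed.

End density_measure.

Lemma measurable_funV (R : realType) : measurable_fun [set: R] (@GRing.inv R).
Proof.
have -> : [set: R] = [set~ 0] `|` [set 0] by rewrite setUC setUv.
apply/measurable_funU; [exact: measurableC|exact: measurable_set1|split].
- apply: subspace_continuous_measurable_fun; first exact: measurableC.
  by apply: continuous_in_subspaceT => x; rewrite inE => /eqP x0; exact: inv_continuous.
- exact: measurable_fun_set1.
Qed.

Lemma measurable_restrict_continuous (R : realType) (f : R -> R) (a b : R) :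
  (forall x, a < x < b -> {for x, continuous f}) ->
  measurable_fun [set: R] (f \_ `]a, b[).
Proof.
move=> cf; apply/(measurable_restrictT _ _).1 => //.
apply: subspace_continuous_measurable_fun => //.
by apply: continuous_in_subspaceT => x; rewrite inE/= in_itv/=; exact: cf.
Qed.

(** * Right inverses of primitives *)

Lemma test_functionP (R : realType) (phi : R -> R) : test_function phi ->
  [/\ forall x : R, is_derive x 1 phi (derive1 phi x), continuous phi,
    continuous (derive1 phi) &
    exists2 M : R, 0 < M & forall x : R, M < `|x| -> phi x = 0 /\ derive1 phi x = 0].
Proof.
move=> [dphi [M phi0]].
have d0 (x : R) : derivable phi x 1 by exact: (dphi 0%N x).
have d1 (x : R) : derivable (derive1 phi) x 1 by exact: (dphi 1%N x).
split.
- by move=> x; apply: DeriveDef => //; rewrite derive1E.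
- by move=> x; apply/differentiable_continuous/derivable1_diffP.
- by move=> x; apply/differentiable_continuous/derivable1_diffP.
exists (`|M| + 1); first by rewrite ltr_pwDr.
move=> x Mx; have {}Mx : M < `|x| by apply: le_lt_trans Mx;
  rewrite (le_trans (ler_norm _))// lerDl.
split; first exact: phi0.
rewrite derive1E -(derive_cst (0 : R) x 1) ; apply: near_eq_derive.
near=> y; apply: phi0; near: y; exact: (cvgr_gt _ (@norm_continuous _ R x) _ Mx).
Unshelve. all: by end_near. Qed.

(** Packages a measure of finite mass in the structure that [ac_density] requires; integrals only
    see its values on measurable sets. *)
Lemma finite_measure_restrT d (T : measurableType d) (R : realType)
    (nu : {measure set T -> \bar R}) :
  (nu setT < +oo)%E -> exists nu' : {finite_measure set T -> \bar R},
    forall A, measurable A -> nu' A = nu A.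
Proof.
move=> nuoo; exists (mfrestr measurableT nuoo) => A mA.
by rewrite -[in RHS](setIT A).
Qed.

Section level_inverse.
Context {R : realType}.
Variables (p G u : R -> R).
Hypotheses (p_ge0 : forall y : R, 0 < y < 1 -> 0 <= p y)
  (p_continuous : forall y : R, 0 < y < 1 -> {for y, continuous p})
  (G_derive : forall y : R, 0 < y < 1 -> is_derive y 1 G (p y))
  (u01 : forall xi : R, 0 < u xi < 1) (uK : cancel u G).
Notation mu := (@lebesgue_measure R).

Let G_continuous (y : R) : 0 < y < 1 -> {for y, continuous G}.
Proof.
by move=> y01; apply/differentiable_continuous/derivable1_diffP; have [] := G_derive y01.
Qed.

Lemma primitive_nondecreasing (x y : R) : 0 < x -> x <= y -> y < 1 -> G x <= G y.
Proof.
move=> x0 xy y1; apply: (@ger0_derive1_le_oo _ G 0 1) => //.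
- by move=> z; rewrite in_itv/= => z01; have [] := G_derive z01.
- by move=> z; rewrite in_itv/= => z01; rewrite derive1E; have [_ ->] := G_derive z01;
    exact: p_ge0.
- by move=> z; rewrite inE/= in_itv/=; exact: G_continuous.
- by rewrite in_itv/= x0 (le_lt_trans xy).
- by rewrite in_itv/= y1 andbT (lt_le_trans x0).
Qed.

(** By continuity [p] stays positive near [m], so [G] gains strictly on a short interval around it.
    The point [m] may be an end point, hence the truncation of that interval to [[x, y]]. *)
Lemma primitive_increasing (m x y : R) : 0 < x -> x < y -> y < 1 ->
  x <= m <= y -> 0 < p m -> G x < G y.
Proof.
move=> x0 xy y1 /andP[xm my] pm.
have m01 : 0 < m < 1 by rewrite (lt_le_trans x0)//= (le_lt_trans my).
have [e /= e0 pe] : nbhs m [set t | 0 < p t].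
  exact: (cvgr_gt (p m) (p_continuous m01) _ pm).
have [s [t [xs st ty sm tm]]] : exists s t,
    [/\ x <= s, s < t, t <= y, m - e < s & t < m + e].
  exists (Num.max x (m - e / 2)), (Num.min y (m + e / 2)).
  by case: (leP x (m - e / 2)); case: (leP y (m + e / 2)) => *; split; lra.
rewrite (le_lt_trans (primitive_nondecreasing x0 xs _))//; first lra.
rewrite (lt_le_trans _ (primitive_nondecreasing _ ty y1))//; last lra.
have st01 z : s <= z <= t -> 0 < z < 1 by move=> /andP[? ?]; apply/andP; split; lra.
have [||c] := @MVT _ G p s t st.
- by move=> z; rewrite in_itv/= => /andP[? ?]; apply: G_derive; apply: st01;
    apply/andP; split; lra.
- apply: continuous_in_subspaceT => z; rewrite inE/= in_itv/= => ?.
  by apply: G_continuous; exact: st01.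
rewrite in_itv/= => /andP[sc ct] Gst; rewrite -subr_gt0 Gst mulr_gt0// ?subr_gt0//.
by apply: pe => /=; rewrite ltr_norml; apply/andP; split; lra.
Qed.

Lemma primitive_inj (y z : R) : 0 < y < 1 -> 0 < z < 1 -> p y != 0 -> G z = G y -> z = y.
Proof.
move=> y01 z01 py Gzy; have {}py : 0 < p y by rewrite lt_neqAle eq_sym py p_ge0.
move: (y01) (z01) => /andP[y0 y1] /andP[z0 z1].
case: (ltgtP z y) => // zy.
- by have := @primitive_increasing y z y z0 zy y1 _ py;
    rewrite Gzy ltxx (ltW zy) lexx => /(_ isT).
- by have := @primitive_increasing y y z y0 zy z1 _ py;
    rewrite Gzy ltxx (ltW zy) lexx => /(_ isT).
Qed.

Lemma primitiveK (y : R) : 0 < y < 1 -> p y != 0 -> u (G y) = y.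
Proof. by move=> y01 py; apply: primitive_inj => //; rewrite uK. Qed.

Lemma level_inverse_increasing : {homo u : x y / x < y}.
Proof.
move=> x y xy; rewrite ltNge; apply/negP => uyx.
have /andP[x0 x1] := u01 x; have /andP[y0 y1] := u01 y.
by have := primitive_nondecreasing y0 uyx x1; rewrite !uK leNgt xy.
Qed.

Lemma level_inverse_nondecreasing : {homo u : x y / x <= y}.
Proof. exact/ltW_homo/level_inverse_increasing. Qed.

(** Zero extensions, to work with measures on the whole line. The artificial value 0 of [Gr] off
    []0, 1[] is harmless, because the density [pr] puts no mass there. *)
Let Gr := G \_ `]0, 1[.
Let pr := p \_ `]0, 1[.

Let GrE (y : R) : 0 < y < 1 -> Gr y = G y.
Proof. by move=> y01; rewrite /Gr patchE ifT// inE/= in_itv. Qed.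

Let prE (y : R) : 0 < y < 1 -> pr y = p y.
Proof. by move=> y01; rewrite /pr patchE ifT// inE/= in_itv. Qed.

Let pr0 (y : R) : ~~ (0 < y < 1) -> pr y = 0.
Proof. by move=> y01; rewrite /pr patchE ifF//; apply/negbTE;
  rewrite notin_setE/= in_itv/=; exact/negP. Qed.

Let mGr : measurable_fun [set: R] Gr.
Proof. by apply: measurable_restrict_continuous. Qed.

Let mpr : measurable_fun [set: R] pr.
Proof. by apply: measurable_restrict_continuous. Qed.

Let pr_ge0 (y : R) : 0 <= pr y.
Proof. by have [y01|y01] := boolP (0 < y < 1); rewrite ?(prE y01) ?p_ge0// pr0. Qed.

Lemma level_inverse_measurable : measurable_fun [set: R] u.
Proof. by apply: nondecreasing_measurable => // x y;
  exact: level_inverse_nondecreasing. Qed.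

(* The image of the measure p(y) dy under G is the Lebesgue measure: on the level
   sets of G that are not singletons, p vanishes. *)
Let lebesgueE A : measurable A ->
  mu A = pushforward (density_measure mu mpr pr_ge0) Gr A.
Proof.
pose nuP := [the measure (measurableTypeR R) R of
  pushforward (density_measure mu mpr pr_ge0) (Gr : measurableTypeR R ->
    measurableTypeR R)].
pose nu : {measure set (measurableTypeR R) -> \bar R} := nuP mGr.
suff H X : ocitv X -> mu X = nu X.
  by move=> mA; exact: (@lebesgue_measure_unique R nu H A mA).
move=> [[a b] _ /= <-].
rewrite /nu /nuP/= /pushforward /density_measure integral_mkcond.
have [ab|ba] := ltP a b; last first.
  rewrite set_itv_ge ?bnd_simp -?leNgt//.
  by rewrite measure0 preimage_set0 -integral_mkcond integral_set0.
have /andP[ua0 ua1] := u01 a; have /andP[ub0 ub1] := u01 b.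
have uab := level_inverse_increasing ab.
rewrite lebesgue_measure_itv/= lte_fin ab.
have ab01 z : u a <= z <= u b -> 0 < z < 1.
  by move=> /andP[? ?]; apply/andP; split; lra.
transitivity (\int[mu]_(x in `[u a, u b]) (p x)%:E)%E.
  rewrite (@continuous_FTC2 _ p G)// ?uK//.
  - apply: continuous_in_subspaceT => z; rewrite inE/= in_itv/= => zab.
    by apply: p_continuous; exact: ab01.
  - split.
    + move=> z; rewrite in_itv/= => /andP[? ?].
      by have [|] := @G_derive z => //; apply: ab01; apply/andP; split; lra.
    + by apply: cvg_at_right_filter; exact: G_continuous.
    + by apply: cvg_at_left_filter; exact: G_continuous.
  - move=> z; rewrite in_itv/= => /andP[? ?]; rewrite derive1E.
    by have [|_ ->] := @G_derive z => //; apply: ab01; apply/andP; split; lra.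
transitivity (\int[mu]_(x in `[u a, u b]) (pr x)%:E)%E.
  by apply: eq_integral => z; rewrite inE/= in_itv/= => /ab01 z01; rewrite prE.
rewrite -integral_itv_obnd_cbnd; last exact/measurable_EFinP/measurable_funTS.
rewrite integral_mkcond; apply: eq_integral => y _; rewrite !patchE.
(* The interval []u a, u b]] and the preimage of []a, b]] can differ only where [pr] vanishes.
   Elsewhere [y = u (G y)], and strict monotonicity of [u] matches the two memberships. *)
have [y01|/pr0 ->] := boolP (0 < y < 1); last by do 2 case: ifPn.
have [py|py] := eqVneq (p y) 0; first by rewrite prE// py; do 2 case: ifPn.
congr (if _ then _ else _).
have u_lt := leW_mono (le_mono level_inverse_increasing).
have u_le := le_mono level_inverse_increasing.
rewrite -[in LHS](primitiveK y01 py); apply/idP/idP.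
- by rewrite !inE/= !in_itv/= GrE// u_lt u_le.
- by rewrite !inE/= !in_itv/= GrE// u_lt u_le.
Qed.

(** The separate [kap] serves integrands built from [u]: [k (G y)] then contains [u (G y)], which
    can be replaced by [y] only in the product with [p y]. *)
Lemma integral_level_inverse (k kap : R -> R) : measurable_fun [set: R] k ->
  (forall y : R, 0 < y < 1 -> k (G y) * p y = kap y) ->
  (\int[mu]_x (k x)%:E = \int[mu]_(y in `]0%R, 1%R[) (kap y)%:E)%E.
Proof.
move=> mk kE; rewrite (@eq_measure_integral _ _ _ _
  (pushforward (density_measure mu mpr pr_ge0) (Gr : measurableTypeR R ->
    measurableTypeR R) : measure (measurableTypeR R) R)); last first.
  by move=> A mA _; exact: lebesgueE.
rewrite (@integral_pushforward_density _ _ _ mu _ mpr pr_ge0 _ (measurableTypeR R) Gr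
  (EFin \o k))//; last exact/measurable_EFinP.
rewrite [RHS]integral_mkcond; apply: eq_integral => y _.
rewrite patchE mem_setE/= in_itv/=; case: ifPn => y01.
  by rewrite /= GrE// prE// -kE.
by rewrite pr0// mule0.
Qed.

Lemma integrable_level_inverse (k kap : R -> R) : measurable_fun [set: R] k ->
  (forall y : R, 0 < y < 1 -> k (G y) * p y = kap y) ->
  mu.-integrable `]0, 1[ (EFin \o kap) -> mu.-integrable [set: R] (EFin \o k).
Proof.
move=> mk kE /integrableP[_ ioo]; apply/integrableP; split; first exact/measurable_EFinP.
rewrite (@integral_level_inverse (fun x => `|k x|) (fun y => `|kap y|))//.
  exact: measurableT_comp.
by move=> y y01; rewrite -kE// normrM (ger0_norm (p_ge0 y01)).
Qed.

Let near01 (y : R) : 0 < y < 1 -> \forall z \near y, 0 < z < 1.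
Proof.
move=> y01; have : y \in `]0, 1[ by rewrite in_itv.
by move/near_in_itvoo; apply: filterS => z; rewrite in_itv.
Qed.

(** [p] is nonzero near [u xi], so [u] is a two-sided inverse of [G] locally and the rule for
    inverse functions applies. *)
Lemma level_inverse_is_derive xi : p (u xi) != 0 -> is_derive xi 1 u (p (u xi))^-1.
Proof.
move=> pxi; rewrite -{1}(uK xi); apply: is_derive_inverse => //.
- near=> y; apply: primitiveK; first by near: y; exact: near01.
  by near: y; exact: (cvgr_neq0 _ (p_continuous (u01 xi)) pxi).
- by near=> y; apply: G_continuous; near: y; exact: near01.
- exact: G_derive.
Unshelve. all: by end_near. Qed.

Lemma level_inverse_continuous xi : p (u xi) != 0 -> {for xi, continuous u}.
Proof.
move=> pxi; apply/differentiable_continuous/derivable1_diffP.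
by have [] := level_inverse_is_derive pxi.
Qed.

Let pu_continuous xi : p (u xi) != 0 -> {for xi, continuous (p \o u)}.
Proof.
move=> pxi; apply: continuous_comp; first exact: level_inverse_continuous.
exact: p_continuous.
Qed.

Lemma level_inverse_C1_at xi : p (u xi) != 0 -> C1_at u xi.
Proof.
move=> pxi; have nz : \forall x \near xi, p (u x) != 0.
  exact: (cvgr_neq0 _ (pu_continuous pxi) pxi).
split.
  by apply: filterS nz => x px; have [] := level_inverse_is_derive px.
rewrite /prop_for /continuous_at derive1E.
have [_ ->] := level_inverse_is_derive pxi.
apply: cvg_trans (cvgV pxi (pu_continuous pxi)); apply: near_eq_cvg.
by apply: filterS nz => x px; rewrite derive1E; have [_ ->] := level_inverse_is_derive px.
Qed.

(** The bounds by values of [u] keep the limit inside []0, 1[], where [p] and [G] are continuous. *)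
Let cvg_right xi : exists2 r, u x @[x --> xi^'+] --> r & u xi <= r <= u (xi + 1).
Proof.
have cu : cvg (u x @[x --> xi^'+]).
  apply: nondecreasing_at_right_is_cvgr.
  - by near=> x => y z _ _; exact: level_inverse_nondecreasing.
  - by near=> x; exists (u xi) => _ [z /= + <-]; rewrite in_itv/= => /andP[/ltW ? _];
      exact: level_inverse_nondecreasing.
exists (lim (u x @[x --> xi^'+])) => //; apply/andP; split.
- by apply: limr_ge => //; near=> x; apply: level_inverse_nondecreasing; near: x;
    exact: nbhs_right_ge.
- by apply: limr_le => //; near=> x; apply: level_inverse_nondecreasing; near: x;
    apply: nbhs_right_le; rewrite ltrDl.
Unshelve. all: by end_near. Qed.

Let cvg_left xi : exists2 l, u x @[x --> xi^'-] --> l & u (xi - 1) <= l <= u xi.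
Proof.
have cu : cvg (u x @[x --> xi^'-]).
  apply: nondecreasing_at_left_is_cvgr.
  - by near=> x => y z _ _; exact: level_inverse_nondecreasing.
  - by near=> x; exists (u xi) => _ [z /= + <-]; rewrite in_itv/= => /andP[_ /ltW ?];
      exact: level_inverse_nondecreasing.
exists (lim (u x @[x --> xi^'-])) => //; apply/andP; split.
- by apply: limr_ge => //; near=> x; apply: level_inverse_nondecreasing; near: x;
    apply: nbhs_left_ge; rewrite ltrBlDr ltrDl.
- by apply: limr_le => //; near=> x; apply: level_inverse_nondecreasing; near: x;
    exact: nbhs_left_le.
Unshelve. all: by end_near. Qed.

(* A one-sided limit r of u at xi is again a point of the level set of xi. *)
Let cvg_side F (xi r : R) : ProperFilter F -> F `=>` nbhs xi -> p (u xi) = 0 ->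
  0 < r < 1 -> u x @[x --> F] --> r -> p (u x) @[x --> F] --> 0.
Proof.
move=> FF Fxi pxi r01 ur.
suff <- : p r = 0 by exact: (continuous_cvg _ (p_continuous r01) ur).
have Gu_r : G (u x) @[x --> F] --> G r by exact: (continuous_cvg _ (G_continuous r01) ur).
have Gu_xi : G (u x) @[x --> F] --> xi.
  by rewrite (_ : (fun x => G (u x)) = id) ?fmap_id//; apply/funext => x; rewrite uK.
have Gr_xi : G r = G (u xi) by rewrite uK; exact: norm_cvg_unique Gu_r Gu_xi.
(* A nonzero [p r] would make the level set of [xi] a singleton, so [r = u xi], against
   [p (u xi) = 0]. *)
apply/eqP/negPn/negP => pr_neq0.
by have uxi := primitive_inj r01 (u01 xi) pr_neq0 (esym Gr_xi);
  rewrite -uxi pxi eqxx in pr_neq0.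
Qed.

(** Finiteness isolates [xi] from the other critical levels, so [u' = 1 / p(u)] on a punctured
    neighbourhood, and [p(u)] tends to 0 through positive values on both sides. The jump has the
    right sign because [l <= u xi <= r]. *)
Lemma level_inverse_saturated xi : finite_set [set x | p (u x) = 0] ->
  p (u xi) = 0 -> saturated u xi.
Proof.
move=> fin pxi.
have [r ur /andP[r1 r2]] := cvg_right xi; have [l ul /andP[l1 l2]] := cvg_left xi.
have /andP[? ?] := u01 xi; have /andP[? ?] := u01 (xi + 1);
  have /andP[? ?] := u01 (xi - 1).
split; last by exists l, r; split => //; exact: le_trans r1.
have nz : \forall x \near xi^', p (u x) != 0.
  have : closed ([set x | p (u x) = 0] `\ xi).
    apply: (accessible_finite_set_closed.1 (@hausdorff_accessible _ _)) => //.
    exact: finite_setD.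
  rewrite -openC openE => /(_ xi) H.
  have {}H : \forall x \near xi^', (~` ([set x | p (u x) = 0] `\ xi)) x.
    by apply: nbhs_dnbhs; apply: H => -[_]; exact.
  apply: filterS2 H (nbhs_dnbhs_neq xi) => x /= H /eqP xxi.
  by apply/eqP => px; apply: H.
suff pu_y : (p (u x))^-1 @[x --> xi^'] --> +oo.
  apply: cvg_trans pu_y; apply: near_eq_cvg; apply: filterS nz => x px.
  by rewrite derive1E; have [_ ->] := level_inverse_is_derive px.
apply: (iffRL (@cvgrVy _ _ (xi^') _ (p \o u) _)).
  by apply: filterS nz => x px; rewrite /= lt_neqAle eq_sym px p_ge0.
apply: (@cvg_at_right_left_dnbhs _ R^o).
- by apply: (cvg_side _ _ pxi _ ur); [exact: cvg_within|apply/andP; split; lra].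
- by apply: (cvg_side _ _ pxi _ ul); [exact: cvg_within|apply/andP; split; lra].
Unshelve. all: by end_near. Qed.

Lemma level_inverse_bounded_variation : bounded_variation_line u.
Proof.
exists 1 => x y xy; rewrite nondecreasing_total_variation//; last first.
  by move=> ? ? _ _; exact: level_inverse_nondecreasing.
by rewrite lee_fin; have /andP[? ?] := u01 x; have /andP[? ?] := u01 y; lra.
Qed.

Let vanishing_outside (f : R -> R) (c d : R) : 0 < c -> c < d -> d < 1 ->
  (forall y : R, 0 < y < 1 -> {for y, continuous f}) ->
  (forall y : R, 0 < y < 1 -> (y < c) || (d < y) -> f y = 0) ->
  mu.-integrable `]0, 1[ (EFin \o f) /\
  (\int[mu]_(y in `]0, 1[) f y = \int[mu]_(y in `[c, d]) f y).
Proof.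
move=> c0 cd d1 cf f0.
have fE : (f \_ `]0, 1[) = (f \_ `[c, d]).
  apply/funext => y; rewrite !patchE !mem_setE/= !in_itv/=.
  case: ifPn => y01; case: ifPn => ycd //.
    by apply: f0 => //; move: ycd; rewrite negb_and -!ltNge.
  by exfalso; move/negP: y01; apply; lra.
have icd : mu.-integrable `[c, d] (EFin \o f).
  apply: continuous_compact_integrable; first exact: segment_compact.
  by apply: continuous_in_subspaceT => y; rewrite inE/= in_itv/= => ?; apply: cf; lra.
split; last by rewrite Rintegral_mkcond fE -Rintegral_mkcond.
apply/integrable_mkcond => //; rewrite restrict_EFin fE -restrict_EFin.
apply/(integrable_mkcond _ _).1 => //.
Qed.

Lemma level_inverse_by_parts (F F' phi : R -> R) :
  (forall y : R, 0 < y < 1 -> is_derive y 1 F (F' y)) ->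
  (forall y : R, 0 < y < 1 -> {for y, continuous F'}) ->
  test_function phi ->
  [/\ mu.-integrable `]0, 1[ (EFin \o (fun y => F y * (derive1 phi (G y) * p y))),
      mu.-integrable `]0, 1[ (EFin \o (fun y => F' y * phi (G y))) &
      \int[mu]_(y in `]0, 1[) (F y * (derive1 phi (G y) * p y)) =
      - \int[mu]_(y in `]0, 1[) (F' y * phi (G y))].
Proof.
move=> dF cF' /test_functionP[dphi cphi cphi' [M M0 phi0]].
have cF (y : R) : 0 < y < 1 -> {for y, continuous F}.
  by move=> y01; apply/differentiable_continuous/derivable1_diffP; have [] := dF y y01.
pose H y := phi (G y); pose H' y := derive1 phi (G y) * p y.
have dH (y : R) : 0 < y < 1 -> is_derive y 1 H (H' y).
  by move=> y01; exact: (is_derive1_comp (dphi _) (G_derive y01)).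
have cH (y : R) : 0 < y < 1 -> {for y, continuous H}.
  by move=> y01; apply/differentiable_continuous/derivable1_diffP; have [] := dH y y01.
have cH' (y : R) : 0 < y < 1 -> {for y, continuous H'}.
  move=> y01; apply: cvgM; last exact: p_continuous.
  exact: (continuous_cvg _ (cphi' (G y)) (G_continuous y01)).
(* As [G c = - (M + 1)] and [G d = M + 1], monotonicity gives [|G y| > M] for y outside []c, d[]. So
   [phi o G] and its derivative vanish there, which kills the boundary terms and any growth of [F]
   at 0 and 1. *)
pose c := u (- (M + 1)); pose d := u (M + 1).
have /andP[c0 c1] : 0 < c < 1 := u01 _; have /andP[d0 d1] : 0 < d < 1 := u01 _.
have cd : c < d by apply: level_inverse_increasing; lra.
have HH0 (y : R) : 0 < y < 1 -> (y <= c) || (d <= y) -> H y = 0 /\ H' y = 0.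
  move=> /andP[y0 y1] ycd; rewrite /H /H'.
  suff /phi0[-> ->] : M < `|G y| by rewrite mul0r.
  rewrite ltr_normr.
  case/orP: ycd => [yc|dy].
  - have : G y <= G c by exact: primitive_nondecreasing.
    by rewrite uK => ?; apply/orP; right; lra.
  - have : G d <= G y by exact: primitive_nondecreasing.
    by rewrite uK => ?; apply/orP; left; lra.
have [||i1 e1] := @vanishing_outside (fun y => F y * H' y) c d c0 cd d1.
- by move=> y y01; apply: cvgM; [exact: cF|exact: cH'].
- by move=> y y01 ycd; have [|_ ->] := HH0 y y01; rewrite ?mulr0//;
    case/orP: ycd => /ltW ->; rewrite ?orbT.
have [||i2 e2] := @vanishing_outside (fun y => F' y * H y) c d c0 cd d1.
- by move=> y y01; apply: cvgM; [exact: cF'|exact: cH].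
- by move=> y y01 ycd; have [|-> _] := HH0 y y01; rewrite ?mulr0//;
    case/orP: ycd => /ltW ->; rewrite ?orbT.
split => //; rewrite e1 e2.
rewrite (@Rintegration_by_parts _ F H F' H')//.
- have [||-> _] := HH0 c; [by rewrite c0|by rewrite lexx|].
  have [||-> _] := HH0 d; [by rewrite d0|by rewrite lexx orbT|].
  by rewrite !mulr0 subrr sub0r.
- by apply: continuous_in_subspaceT => y; rewrite inE/= in_itv/= => ?; apply: cF'; lra.
- split.
  + by move=> y; rewrite in_itv/= => ?; have [|] := dF y => //; lra.
  + by apply: cvg_at_right_filter; apply: cF; rewrite c0.
  + by apply: cvg_at_left_filter; apply: cF; rewrite d0.
- by move=> y; rewrite in_itv/= => ?; rewrite derive1E; have [|_ ->] := dF y => //; lra.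
- by apply: continuous_in_subspaceT => y; rewrite inE/= in_itv/= => ?; apply: cH'; lra.
- split.
  + by move=> y; rewrite in_itv/= => ?; have [|] := dH y => //; lra.
  + by apply: cvg_at_right_filter; apply: cH; rewrite c0.
  + by apply: cvg_at_left_filter; apply: cH; rewrite d0.
- by move=> y; rewrite in_itv/= => ?; rewrite derive1E; have [|_ ->] := dH y => //; lra.
Qed.

Lemma Rintegral_level_inverse (k kap : R -> R) : measurable_fun [set: R] k ->
  (forall y : R, 0 < y < 1 -> k (G y) * p y = kap y) ->
  \int[mu]_x k x = \int[mu]_(y in `]0, 1[) kap y.
Proof. by move=> mk kE; rewrite /Rintegral (integral_level_inverse mk kE). Qed.

(* Both integrals become integrals over ]0, 1[ under xi = G y, where they are
   related by an integration by parts: F(u) is a primitive of - b even across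
   the jumps of u, because F' vanishes on the level sets that u skips. *)
Lemma level_inverse_weak_equation (F F' w b phi : R -> R) :
  (forall y : R, 0 < y < 1 -> is_derive y 1 F (F' y)) ->
  (forall y : R, 0 < y < 1 -> {for y, continuous F'}) ->
  measurable_fun [set: R] w -> measurable_fun [set: R] b ->
  (forall y : R, 0 < y < 1 -> w (G y) * p y = F y * p y) ->
  (forall y : R, 0 < y < 1 -> b (G y) * p y = - F' y) ->
  test_function phi ->
  [/\ mu.-integrable [set: R] (EFin \o (fun x => w x * derive1 phi x)),
      mu.-integrable [set: R] (EFin \o (fun x => b x * phi x)) &
      \int[mu]_x (w x * derive1 phi x) = \int[mu]_x (b x * phi x)].
Proof.
move=> dF cF' mw mb wE bE tphi.
have [_ /continuous_measurable_fun mphi /continuous_measurable_fun mphi' _] :=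
  test_functionP tphi.
have [i1 i2 e] := level_inverse_by_parts dF cF' tphi.
have wE' (y : R) : 0 < y < 1 ->
    w (G y) * derive1 phi (G y) * p y = F y * (derive1 phi (G y) * p y).
  by move=> y01; rewrite mulrAC wE// mulrAC mulrA.
have bE' (y : R) : 0 < y < 1 -> b (G y) * phi (G y) * p y = - (F' y * phi (G y)).
  by move=> y01; rewrite mulrAC bE// mulNr.
split.
- by apply: (integrable_level_inverse _ wE') => //; exact: measurable_funM.
- by apply: (integrable_level_inverse _ bE');
    [exact: measurable_funM|apply: eq_integrable (integrableN i2)].
rewrite (Rintegral_level_inverse _ wE'); last exact: measurable_funM.
rewrite (Rintegral_level_inverse _ bE'); last exact: measurable_funM.
rewrite e -[LHS]mulN1r -RintegralZl//.
by apply: eq_Rintegral => y _; rewrite mulN1r.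
Qed.

(* The derivative of u is the image under G of the Lebesgue measure on ]0, 1[.
   The part carried by the zeros of p is mapped onto the finitely many
   critical levels, hence singular. *)
Lemma level_inverse_ac_density : finite_set [set x | p (u x) = 0] ->
  ac_density u (fun x => (p (u x))^-1).
Proof.
(* Because [0^-1 = 0], [ind] is the indicator of the set where [pr] is nonzero, and it is measurable
   by construction. [q] is the indicator of the zeros of [p] in []0, 1[]; its image under [G] will
   be the singular part of Du. *)
move=> fin; pose ind y := pr y * (pr y)^-1; pose q := (fun y => 1 - ind y) \_ `]0, 1[.
have mu_u : measurable_fun [set: R] u := level_inverse_measurable.
have mh : measurable_fun [set: R] (fun x => (p (u x))^-1).
  rewrite (_ : (fun x => (p (u x))^-1) = (@GRing.inv R) \o (pr \o u)).
    apply: measurableT_comp; first exact: measurable_funV.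
    exact: measurableT_comp.
  by apply/funext => x /=; rewrite prE.
have mind : measurable_fun [set: R] ind.
  apply: measurable_funM => //; apply: (measurableT_comp (@measurable_funV R)) => //.
have indE (y : R) : ind y = (pr y != 0)%:R.
  by rewrite /ind; have [->|py] := eqVneq (pr y) 0; rewrite ?mul0r// divff.
have ind01 (y : R) : 0 <= ind y <= 1 by rewrite indE; case: (_ != _);
  rewrite ?lexx ?ler01.
have mq : measurable_fun [set: R] q.
  apply/(measurable_restrictT _ _).1 => //; apply: measurable_funTS.
  exact: measurable_funB.
have qE (y : R) : 0 < y < 1 -> q y = 1 - ind y.
  by move=> y01; rewrite /q patchE mem_setE/= in_itv/= y01.
have q0 (y : R) : ~~ (0 < y < 1) -> q y = 0.
  by move=> y01; rewrite /q patchE mem_setE/= in_itv/= (negbTE y01).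
have q_ge0 (y : R) : 0 <= q y.
  by have [/qE ->|/q0 ->//] := boolP (0 < y < 1); rewrite subr_ge0;
    have /andP[] := ind01 y.
have hE (y : R) : 0 < y < 1 -> (p (u (G y)))^-1 * p y = ind y.
  move=> y01; rewrite indE prE//; have [->|py] := eqVneq (p y) 0; first by rewrite mulr0.
  by rewrite primitiveK// mulVf.
have bounded_int (k : R -> R) : measurable_fun [set: R] k ->
    (forall y, 0 <= k y <= 1) -> mu.-integrable `]0, 1[ (EFin \o k).
  move=> mk k01; apply: measurable_bounded_integrable => //.
  - by rewrite /= lebesgue_measure_itv/= lte_fin ltr01 -EFinB ltry.
  - exact: measurable_funTS.
  - exists 1; split=> // M M1 y _ /=; have /andP[i0 i1] := k01 y.
    by rewrite ger0_norm// (le_trans i1)// ltW.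
split; first exact: (integrable_level_inverse mh hE (bounded_int _ mind ind01)).
pose nuP := [the measure _ _ of pushforward (density_measure mu mq q_ge0) Gr].
pose nu := nuP mGr.
have nu_int (k : R -> R) : measurable_fun [set: R] k ->
    (\int[nu]_x (k x)%:E = \int[mu]_(y in `]0%R, 1%R[) (k (G y) * (1 - ind y))%:E)%E.
  move=> mk.
  rewrite (@integral_pushforward_density _ _ _ mu _ mq q_ge0 _ _ Gr (EFin \o k))//;
    last exact/measurable_EFinP.
  rewrite [RHS]integral_mkcond; apply: eq_integral => y _.
  rewrite patchE mem_setE/= in_itv/=; case: ifPn => y01.
    by rewrite /= GrE// qE.
  by rewrite q0// mule0.
have iq : mu.-integrable [set: R] (EFin \o q).
  rewrite /q -restrict_EFin; apply/(integrable_mkcond _ _).1 => //.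
  apply: bounded_int => [|y]; first exact: measurable_funB.
  by have /andP[? ?] := ind01 y; apply/andP; split; lra.
have nuoo : (nu setT < +oo)%E.
  by rewrite /nu /nuP /= /pushforward /density_measure preimage_setT;
    exact: (integrable_lty measurableT iq).
have [nu1 nu1E] := @finite_measure_restrT _ _ R nu nuoo.
(* [u] is nondecreasing, so its singular part has no negative component. *)
have [nu2 nu2E] := @finite_measure_restrT _ R R mzero (ltry 0).
have mN : measurable [set x | p (u x) = 0].
  apply: closed_measurable.
  exact: (accessible_finite_set_closed.1 (@hausdorff_accessible _ _) _ fin).
exists nu1, nu2, [set x | p (u x) = 0]; split.
- exact: mN.
- exact: (countable_lebesgue_measure0 (finite_set_countable fin)).
- rewrite nu1E; last exact: measurableC.
  rewrite /nu /nuP /= /pushforward /density_measure; apply: integral0_eq => y /= Ny.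
  have [y01|/q0 ->//] := boolP (0 < y < 1); rewrite qE// indE prE//.
  have [py|_] := eqVneq (p y) 0; last by rewrite subrr.
  (* A zero y of [p] lies over a critical level: otherwise [p (u (G y))] is nonzero, the level set
     is the single point [u (G y)], and y is that point. *)
  exfalso; apply: Ny => /=; rewrite GrE//; apply/eqP/negPn/negP => pu.
  have yE : y = u (G y) by apply: primitive_inj => //; rewrite uK.
  by rewrite -yE py eqxx in pu.
- by rewrite nu2E//; exact: measurableC.
move=> phi tphi.
have [_ /continuous_measurable_fun mphi /continuous_measurable_fun mphi' _] :=
  test_functionP tphi.
(* Integrating by parts with [F = id] leaves the integral of [phi o G]; splitting
   [1 = ind + (1 - ind)] under it separates the absolutely continuous part from the singular one. *)
have d1 (y : R) : 0 < y < 1 -> is_derive y 1 id (1 : R) by move=> _; exact: is_derive_id.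
have c1 (y : R) : 0 < y < 1 -> {for y, continuous (cst (1 : R))} by move=> _;
  exact: cvg_cst.
have [_ i2 e] := level_inverse_by_parts d1 c1 tphi.
rewrite (Rintegral_level_inverse (kap := fun y => y * (derive1 phi (G y) * p y)));
  last 2 first.
- exact: measurable_funM.
- move=> y y01; have [->|py] := eqVneq (p y) 0; first by rewrite !mulr0.
  by rewrite primitiveK// mulrA.
have phiE (y : R) : 0 < y < 1 -> phi (G y) * (p (u (G y)))^-1 * p y = phi (G y) * ind y.
  by move=> y01; rewrite -mulrA hE.
rewrite e (Rintegral_level_inverse _ phiE); last exact: measurable_funM.
have -> : \int[nu2]_x phi x = 0.
  by rewrite /Rintegral (@eq_measure_integral _ _ _ _ mzero) ?integral_measure_zero//
    => A mA _; exact: nu2E.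
have -> : \int[nu1]_x phi x = \int[mu]_(y in `]0, 1[) (phi (G y) * (1 - ind y)).
  by rewrite /Rintegral -nu_int// (@eq_measure_integral _ _ _ _ nu)// => A mA _;
    exact: nu1E.
have phi_int (k : R -> R) : measurable_fun [set: R] k -> (forall y, 0 <= k y <= 1) ->
    mu.-integrable `]0, 1[ (EFin \o (fun y => phi (G y) * k y)).
  move=> mk k01; apply: le_integrable i2 => //.
    apply/measurable_EFinP; apply: measurable_funM; last exact: measurable_funTS.
    apply: (eq_measurable_fun (phi \o Gr)).
      by move=> y; rewrite inE/= in_itv/= => y01; rewrite GrE.
    by apply: measurable_funTS; exact: measurableT_comp.
  move=> y _; rewrite /= lee_fin mul1r normrM ler_piMr//.
  by have /andP[? ?] := k01 y; rewrite ger0_norm.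
rewrite subr0 -RintegralD//.
- by congr (- _); apply: eq_Rintegral => y _; rewrite mul1r -mulrDr addrC subrK mulr1.
- exact: phi_int.
- apply: phi_int => [|y]; first exact: measurable_funB.
  by have /andP[? ?] := ind01 y; apply/andP; split; lra.
Qed.

End level_inverse.

(** * The flux and the reduced equation *)

Lemma ge0_is_derive_le (R : realType) (F dF : R -> R) (x y : R) : x <= y ->
  (forall z : R, x < z < y -> is_derive z 1 F (dF z)) ->
  {within `[x, y], continuous F} -> (forall z, x < z < y -> 0 <= dF z) ->
  F x <= F y.
Proof.
rewrite le_eqVlt => /predU1P[->//|xy] dFz cF dF0.
have dFz' z : z \in `]x, y[ -> is_derive z 1 F (dF z) by rewrite in_itv; exact: dFz.
have [c cxy FE] := MVT xy dFz' cF.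
rewrite -subr_ge0 FE mulr_ge0//; last by rewrite subr_ge0 ltW.
by apply: dF0; move: cxy; rewrite in_itv.
Qed.

Lemma unbounded_below_log (R : realType) (F dF : R -> R) (x k : R) : 0 < x -> 0 < k ->
  (forall z : R, 0 < z <= x -> is_derive z 1 F (dF z)) ->
  (forall z, 0 < z <= x -> k / z <= dF z) ->
  forall B, exists2 y, 0 < y <= x & F y < B.
Proof.
(* [F - k ln] is nondecreasing on []0, x]], so at [y = x * expR (- t)] one has [F y <= F x - k * t].
   The quotient makes this at most [B - 1]; the maximum with 0 keeps [y <= x]. *)
move=> x0 k0 dFz dFk B; pose t := Num.max 0 ((F x - B + 1) / k).
have t0 : 0 <= t by rewrite le_max lexx.
have Bt : F x - k * t < B.
  have : (F x - B + 1) / k <= t by rewrite le_max lexx orbT.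
  by rewrite ler_pdivrMr// => ?; lra.
pose y := x * expR (- t); have y0 : 0 < y by rewrite mulr_gt0 ?expR_gt0.
have yx : y <= x by rewrite ger_pMr// -expR0 ler_expR oppr_le0.
exists y; first by rewrite y0.
apply: le_lt_trans Bt.
have lny : ln y = ln x - t by rewrite lnM ?posrE ?expR_gt0// expRK.
pose E z := F z - k * ln z.
have dE (z : R) : 0 < z <= x -> is_derive z 1 E (dF z - k * z^-1).
  move=> zx; have z0 : 0 < z by case/andP: zx.
  by apply: is_deriveB; [exact: dFz|apply: is_deriveZ; exact: is_derive1_ln].
have : E y <= E x.
  apply: (@ge0_is_derive_le _ E (fun z => dF z - k * z^-1)) => //.
  - by move=> z /andP[yz zx]; apply: dE; rewrite (lt_trans y0) ?ltW.
  - apply: continuous_in_subspaceT => z; rewrite inE/= in_itv/= => /andP[yz zx].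
    apply/differentiable_continuous/derivable1_diffP.
    by have [|] := dE z => //; rewrite (lt_le_trans y0).
  - by move=> z /andP[yz zx]; rewrite subr_ge0 dFk// (lt_trans y0) ?ltW.
by rewrite /E lny; lra.
Qed.

Lemma exists_between0 (R : realType) (r s t : R) : 0 < r -> 0 < s -> 0 < t ->
  exists x, [/\ 0 < x, x < r, x < s & x < t].
Proof.
move=> r0 s0 t0; exists (Num.min (Num.min r s) t / 2).
have m0 : 0 < Num.min (Num.min r s) t by rewrite !lt_min r0 s0 t0.
have : Num.min (Num.min r s) t <= Num.min r s by rewrite ge_min lexx.
rewrite le_min => /andP[? ?].
have : Num.min (Num.min r s) t <= t by rewrite ge_min lexx orbT.
by move: m0; split; lra.
Qed.

(** With a base point [c] to the left of both [x] and [y], either orientation equals [F z - F x] for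
    the primitive [F] from [c], so one application of the fundamental theorem suffices. *)
Lemma oriented_integral_is_derive (R : realType) (k : R -> R) (a b x y : R) :
  (forall z : R, a < z < b -> {for z, continuous k}) -> a < x < b -> a < y < b ->
  is_derive y 1 (oriented_integral k x) (k y).
Proof.
move=> ck /andP[ax xb] /andP[ay yb].
have [c [ac cx cy]] : exists c, [/\ a < c, c < x & c < y].
  by exists ((a + Num.min x y) / 2); case: (leP x y) => ?; split; lra.
have [d [db xd yd]] : exists d, [/\ d < b, x < d & y < d].
  by exists ((b + Num.max x y) / 2); case: (leP x y) => ?; split; lra.
have icd s : s <= d -> lebesgue_measure.-integrable `[c, s] (EFin \o k).
  move=> sd; apply: continuous_compact_integrable; first exact: segment_compact.
  apply: continuous_in_subspaceT => z; rewrite inE/= in_itv/= => /andP[? ?].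
  by apply: ck; apply/andP; split; lra.
pose F z := \int[lebesgue_measure]_(t in `[c, z]) k t.
have [dF FE] := continuous_FTC1_closed yd (icd d (lexx _)) cy (ck y (introT andP (conj
  ay yb))).
have : is_derive y 1 (fun z => F z - F x) (k y).
  rewrite -[k y]subr0; apply: is_deriveB; apply: DeriveDef; first exact: dF.
  by rewrite -derive1E.
have sub s t : c < s -> s <= t -> t <= d ->
    \int[lebesgue_measure]_(z in `[s, t]) k z = F t - F s.
  move=> cs st td; rewrite (@Rintegral_itvB _ k (BLeft c) (BRight t) s) ?bnd_simp ?(ltW
    cs)//; last exact: icd.
  rewrite Rintegral_itv_obnd_cbnd//.
  apply: integrableS (icd t td) => //; apply: subset_itv; rewrite bnd_simp//; exact: ltW.
apply: near_eq_is_derive; near=> z.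
have cz : c < z by near: z; exact: lt_nbhsr.
have zd : z < d by near: z; exact: lt_nbhsl.
rewrite /oriented_integral; case: leP => xz; first by rewrite sub// ltW.
by rewrite sub ?opprB// ltW.
Unshelve. all: by end_near. Qed.

Section affine_growth_flux.
Context {R : realType}.
Variables (omega : R -> \bar R) (a : R -> R -> R) (abar atilde : R).
Hypotheses (homega : flux_domain omega) (ha : flux omega a)
  (haC1 : flux_C1 omega a)
  (has : forall u s, Omega omega (u, s) -> 0 < derive1 (a u) s)
  (habar : 0 < abar)
  (hgrowth : forall u s, Omega omega (u, s) -> `|a u s| <= abar * `|s| + atilde).

(** Throughout, [a u] is handled through inequalities at fixed arguments, so that the implicit
    inverse [g] rarely has to be manipulated. *)
Implicit Types u v w s t c e y z : R.

Lemma omega_pinfty u : 0 <= u <= 1 -> omega u = +oo%E.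
Proof.
move=> u01; have om0 := homega.1 u u01; have [_ _ _ /(_ u u01)] := ha.
rewrite /aplus; case E : (omega u) om0 => [r| |]//;
  rewrite lte_fin => r0 /(_ (ltry _)) alim.
have [cv|dv] := pselect (cvg ((a u s)%:E @[s --> r^'-])).
- have : (lim ((a u s)%:E @[s --> r^'-]) <= (abar * r + atilde)%:E)%E.
    apply: lime_le => //; near=> s; rewrite lee_fin (le_trans (ler_norm _))//.
    have s0 : 0 < s by near: s; exact: nbhs_left_gt.
    have sr : s < r by near: s; exact: nbhs_left_lt.
    apply: le_trans (hgrowth _) _.
      by split => //=; rewrite E !lte_fin; apply/andP; split; lra.
    by rewrite gtr0_norm// lerD2r ler_pM2l// ltW.
  by rewrite alim.
(* Without convergence [lim] returns a default point, which is not [+oo]. *)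
- by move: alim; rewrite (dvgP dv).
Unshelve. all: by end_near. Qed.

Let OmegaT u s : 0 <= u <= 1 -> Omega omega (u, s).
Proof. by move=> u01; split => //=; rewrite omega_pinfty// ltNye ltry. Qed.

Let a_incr u : 0 <= u <= 1 -> {homo a u : s t / s < t}.
Proof. by move=> u01 s t; have [_ _ h _] := ha; apply: h; exact: OmegaT. Qed.

Let a_lt u : 0 <= u <= 1 -> {mono a u : s t / s < t}.
Proof. by move=> u01; apply/leW_mono/le_mono; exact: a_incr. Qed.

Let a_le u : 0 <= u <= 1 -> {mono a u : s t / s <= t}.
Proof. by move=> u01; apply/le_mono; exact: a_incr. Qed.

Lemma flux_at0 u : 0 <= u <= 1 -> a u 0 = 0.
Proof.
move=> u01; have [_ h _ _] := ha.
by have := h u 0 (OmegaT 0 u01); rewrite oppr0; lra.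
Qed.

Let a_derive u s : 0 <= u <= 1 -> is_derive s 1 (a u) (derive1 (a u) s).
Proof.
move=> u01; have [au [as_ [_ _ _ h]]] := haC1.
have [? _] := h u s (OmegaT s u01).
by apply: DeriveDef => //; rewrite derive1E.
Qed.

Let a_continuous u : 0 <= u <= 1 -> continuous (a u).
Proof.
move=> u01 s; apply/differentiable_continuous/derivable1_diffP.
by have [] := a_derive s u01.
Qed.

Let a_continuousl u s : 0 < u < 1 -> {for u, continuous (a ^~ s)}.
Proof.
move=> u01; have [au [as_ [_ _ h _]]] := haC1.
have [|? _] := h u s _ u01; first by apply: OmegaT; case/andP: u01 => /ltW -> /ltW ->.
exact/differentiable_continuous/derivable1_diffP.
Qed.

Lemma lt_aplus u v : 0 <= u <= 1 -> (v%:E < aplus omega a u)%E <-> exists s, v < a u s.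
Proof.
move=> u01; rewrite /aplus omega_pinfty//.
have nd : nondecreasing_fun (fun s => (a u s)%:E).
  by move=> s t st; rewrite lee_fin a_le.
rewrite (cvg_lim _ (nondecreasing_cvge nd))//; split.
- by move=> /ereal_sup_gt[_ [s _ <-]]; rewrite lte_fin => ?; exists s.
- move=> [s vs]; apply: (@lt_le_trans _ _ (a u s)%:E); first by rewrite lte_fin.
  by apply: ereal_sup_ubound; exists s.
Qed.

Let aminus_le0 u : 0 <= u <= 1 -> (aminus omega a u <= 0)%E.
Proof.
move=> u01; rewrite /aminus omega_pinfty//.
have [cv|dv] := pselect (cvg ((a u s)%:E @[s --> -oo])); last by rewrite (dvgP dv).
apply: lime_le => //; near=> s; rewrite lee_fin -(flux_at0 u01) a_le//.
Unshelve. all: by end_near. Qed.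

Let gP u v : 0 <= u <= 1 -> 0 < v -> (v%:E < aplus omega a u)%E ->
  a u (g omega a u v) = v.
Proof.
move=> u01 v0 va; have [S vS] := (lt_aplus v u01).1 va.
have S0 : 0 < S by rewrite -(a_lt u01) flux_at0// (lt_trans v0).
have [||s _ sv] := @IVT _ (a u) 0 S v (ltW S0).
- by apply: continuous_in_subspaceT => x _; exact: a_continuous.
- rewrite flux_at0//; case: (leP 0 (a u S)) => ?; apply/andP; split; lra.
suff : [set s | [/\ calD omega a (u, v), Omega omega (u, s) & a u s = v]] (g omega a u
  v) by case.
apply: (@xgetPex _ 0); exists s; split => //; last exact: OmegaT.
by split => //=; rewrite va andbT (le_lt_trans (aminus_le0 u01))// lte_fin.
Qed.

Lemma calH_ge0 u v : 0 <= u <= 1 -> 0 < v -> 0 <= calH omega a u v.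
Proof.
move=> u01 v0; rewrite /calH; case: ifPn => // va.
by rewrite invr_ge0 -(a_le u01) gP// flux_at0// ltW.
Qed.

(** One criterion for both branches of [calH]. Together with [calH_gt] it replaces the reciprocal of
    an implicit inverse by inequalities on [a], from which monotonicity, continuity and the lower
    bound of [calH] follow. *)
Lemma calH_lt u v c : 0 <= u <= 1 -> 0 < v -> 0 < c ->
  (calH omega a u v < c) = (a u c^-1 < v).
Proof.
move=> u01 v0 c0; rewrite /calH; case: ifPn => va.
  have g0 : 0 < g omega a u v by rewrite -(a_lt u01) gP// flux_at0.
  by rewrite -[in RHS](gP u01 v0 va) a_lt// invf_plt.
(* Here all values of [a u] are at most [v]; passing through [c^-1 + 1] makes the inequality at
   [c^-1] strict. *)
rewrite c0; apply/esym; rewrite (@lt_le_trans _ _ (a u (c^-1 + 1)))//.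
  by rewrite a_lt// ltrDl.
by rewrite leNgt; apply/negP => h; move/negP: va; apply; apply/(lt_aplus v u01);
  exists (c^-1 + 1).
Qed.

Lemma calH_gt u v c : 0 <= u <= 1 -> 0 < v -> 0 < c ->
  (c < calH omega a u v) = (v < a u c^-1).
Proof.
move=> u01 v0 c0; rewrite /calH; case: ifPn => va.
  have g0 : 0 < g omega a u v by rewrite -(a_lt u01) gP// flux_at0.
  by rewrite -[in RHS](gP u01 v0 va) a_lt// invf_pgt.
rewrite ltNge (ltW c0)/=; apply/esym/negbTE; apply/negP => h; move/negP: va; apply.
by apply/(lt_aplus v u01); exists c^-1.
Qed.

Lemma a_calHV u v : 0 <= u <= 1 -> 0 < v -> calH omega a u v != 0 ->
  a u (calH omega a u v)^-1 = v.
Proof.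
move=> u01 v0 H0; have Hp : 0 < calH omega a u v by rewrite lt_neqAle eq_sym H0 calH_ge0.
apply/le_anti; rewrite !leNgt -calH_lt// -calH_gt// ltxx//.
Qed.

Lemma calH_nincr u v w : 0 <= u <= 1 -> 0 < v -> v <= w ->
  calH omega a u w <= calH omega a u v.
Proof.
move=> u01 v0 vw; have w0 := lt_le_trans v0 vw.
rewrite leNgt; apply/negP => /midf_lt [h1 h2].
have c0 := le_lt_trans (calH_ge0 u01 v0) h1.
by move: h1 h2; rewrite calH_lt// calH_gt//; lra.
Qed.

(** By the two criteria, bounds on [calH] by a fixed constant become the sign of [a z c - V z] at a
    fixed c, an open condition in z. Points where [V] meets [aplus] are covered with no case
    distinction. *)
Lemma calH_continuous (V : R -> R) y : 0 < y < 1 -> {for y, continuous V} ->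
  (forall z, 0 < z < 1 -> 0 < V z) ->
  {for y, continuous (fun z => calH omega a z (V z))}.
Proof.
move=> y01 cV V0; have in01 (z : R) : 0 < z < 1 -> 0 <= z <= 1.
  by move=> /andP[/ltW -> /ltW ->].
have near01 : \forall z \near y, 0 < z < 1.
  have : y \in `]0, 1[ by rewrite in_itv.
  by move/near_in_itvoo; apply: filterS => z; rewrite in_itv.
have aV c : {for y, continuous (fun z => a z c - V z)}.
  by apply: continuousB => //; exact: a_continuousl.
apply/cvgrPdist_le => e e0; set h := calH omega a y (V y).
have h0 : 0 <= h by apply: calH_ge0; [exact: in01|exact: V0].
have near_lt : \forall z \near y, calH omega a z (V z) < h + e.
  have he : 0 < h + e by lra.
  have : a y (h + e)^-1 - V y < 0.
    by rewrite subr_lt0 -calH_lt// ?in01 ?V0// -/h ltrDl.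
  move=> /(cvgr_lt _ (aV _)) H; near=> z.
  have z01 : 0 < z < 1 by near: z.
  by rewrite calH_lt// ?in01 ?V0// -subr_lt0; near: z.
have near_gt : \forall z \near y, h - e <= calH omega a z (V z).
  have [he|he] := leP (h - e) 0.
    near=> z; have z01 : 0 < z < 1 by near: z.
    by rewrite (le_trans he)// calH_ge0// ?in01 ?V0.
  have : 0 < a y (h - e)^-1 - V y.
    by rewrite subr_gt0 -calH_gt// ?in01 ?V0// -/h ltrBlDr ltrDl.
  move=> /(cvgr_gt _ (aV _)) H; near=> z; apply/ltW.
  have z01 : 0 < z < 1 by near: z.
  by rewrite calH_gt// ?in01 ?V0// -subr_gt0; near: z.
near=> z; rewrite ler_norml; apply/andP.
have : calH omega a z (V z) < h + e by near: z.
have : h - e <= calH omega a z (V z) by near: z.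
by split; lra.
Unshelve. all: by end_near. Qed.

(* Near an end point e of [0, 1], as a(u, s) >= m s for small s, g(u, v) <= v / m. *)
Lemma calH_lower_bound e : 0 <= e <= 1 -> exists m d, [/\ 0 < m, 0 < d &
  forall u v, 0 <= u <= 1 -> `|u - e| < d -> 0 < v < d -> m / v <= calH omega a u v].
Proof.
move=> e01; have [au [as_ [_ cas _ das]]] := haC1.
have asE u s : 0 <= u <= 1 -> derive1 (a u) s = as_ (u, s).
  by move=> u01; rewrite derive1E; have [_ ->] := das u s (OmegaT s u01).
have as0 : 0 < as_ (e, 0) by rewrite -asE//; apply: has; exact: OmegaT.
pose m := as_ (e, 0) / 2; have m0 : 0 < m by rewrite divr_gt0.
have m2 : m < as_ (e, 0) by rewrite /m; lra.
have := (@subspace_continuousP _ (Omega omega) _ as_).1 cas (e, 0) (OmegaT 0 e01).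
move=> /(cvgr_gt _) /(_ m m2); rewrite near_withinE => /nbhs_ballP[d /= d0 Hd].
(* [v < m * d] puts [v / m], hence the mean value point below it, in the ball where the s-derivative
   of [a] exceeds m, half its value at [(e, 0)]. *)
exists m, (Num.min d (m * d)); split => //.
  by rewrite lt_min d0 mulr_gt0.
move=> u v u01; rewrite !lt_min => /andP[ud _] /andP[v0 /andP[vd vmd]].
rewrite leNgt calH_lt ?divr_gt0// invf_div -leNgt.
have s0 : 0 < v / m by rewrite divr_gt0.
have sd : v / m < d by rewrite ltr_pdivrMr// mulrC.
have [||c] := @MVT _ (a u) (derive1 (a u)) 0 (v / m) s0.
- by move=> z _; exact: a_derive.
- by apply: continuous_in_subspaceT => z _; exact: a_continuous.
rewrite in_itv/= => /andP[c0 cs]; rewrite flux_at0// !subr0 => ->.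
have mc : m < derive1 (a u) c.
  rewrite asE//; apply: Hd; last exact: OmegaT.
  split; rewrite /ball/=; first by rewrite distrC.
  by rewrite sub0r normrN gtr0_norm// (lt_trans cs).
by rewrite mulrA ler_pdivlMr// mulrC ler_pM2r// ltW.
Qed.

(** * Comparison of solutions of the reduced equation *)

Variable f : R -> R.
Hypothesis hf : reaction f.

Lemma calV_is_derive sigma V y : is_calV omega a f sigma V -> 0 < y < 1 ->
  is_derive y 1 V (sigma - f y * calH omega a y (V y)).
Proof.
move=> [_ _ hV] y01; have [[/nbhs_singleton dV _] _ <-] := hV y y01.
by apply: DeriveDef => //; rewrite derive1E.
Qed.

Let calV_continuous sigma V y : is_calV omega a f sigma V -> 0 < y < 1 ->
  {for y, continuous V}.
Proof.
move=> hV y01; apply/differentiable_continuous/derivable1_diffP.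
by have [] := calV_is_derive hV y01.
Qed.

Let calV_gt0 sigma V y : is_calV omega a f sigma V -> 0 < y < 1 -> 0 < V y.
Proof. by move=> [_ _ hV] /hV[]. Qed.

Let f_gt0 y : 0 < y < 1 -> 0 < f y.
Proof. by have [_ _ _] := hf; exact. Qed.

Let in01 y : 0 < y < 1 -> 0 <= y <= 1.
Proof. by move=> /andP[/ltW -> /ltW ->]. Qed.

(* If W - V were positive at y, then W - V + eps (x - 1) would have a positive
   maximum on [y, 1], attained before 1, at a point where it increases strictly. *)
Lemma calV_le sigma tau V W y : sigma <= tau ->
  is_calV omega a f sigma V -> is_calV omega a f tau W -> 0 < y < 1 -> W y <= V y.
Proof.
move=> st hV hW y01; rewrite leNgt; apply/negP => VW.
pose D z := W z - V z; have Dy0 : 0 < D y by rewrite subr_gt0.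
(* Small enough that the tilted difference stays positive at y, since [1 - y < 1]; at 1 it is 0. *)
pose eps := D y / 2; have eps0 : 0 < eps by rewrite divr_gt0.
pose E z := D z + eps * (z - 1); have /andP[y0 y1] := y01.
have cD : {within `[y, 1], continuous D}.
  have sub : `[y, 1] `<=` `[0, 1].
    by move=> z /=; rewrite !in_itv/= => /andP[? ->]; rewrite (le_trans (ltW y0)).
  have [cV _ _] := hV; have [cW _ _] := hW.
  by move=> z; apply: cvgB;
    [exact: (continuous_subspaceW sub cW)|exact: (continuous_subspaceW sub cV)].
have cE : {within `[y, 1], continuous E}.
  have cL : {within `[y, 1], continuous (fun z => eps * (z - 1))}.
    apply: continuous_subspaceT => z; apply: cvgM; first exact: cvg_cst.
    by apply: cvgB; [exact: cvg_id|exact: cvg_cst].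
  by move=> z; apply: cvgD; [exact: cD|exact: cL].
have [m] := EVT_max (ltW y1) cE; rewrite in_itv/= => /andP[ym m1] maxE.
have Ey0 : 0 < E y by rewrite /E /eps; nra.
have Em0 : 0 < E m by apply: lt_le_trans Ey0 (maxE y _); rewrite in_itv/= lexx ltW.
have {}m1 : m < 1.
  rewrite lt_neqAle m1 andbT; apply/eqP => m1E; move: Em0.
  by rewrite m1E /E /D; have [_ -> _] := hV; have [_ -> _] := hW;
    rewrite !subrr mulr0 addr0 ltxx.
have m01 : 0 < m < 1 by rewrite m1 (lt_le_trans y0).
have Dm0 : 0 < D m by move: Em0; rewrite /E; nra.
have cDm : {for m, continuous D}.
  by apply: cvgB; [exact: calV_continuous hW m01|exact: calV_continuous hV m01].
have [d /= d0 Dd] : nbhs m [set z | 0 < D z] := cvgr_gt _ cDm _ Dm0.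
pose t := Num.min (m + d / 2) ((m + 1) / 2).
have [mt tmd t1] : [/\ m < t, t < m + d & t < 1].
  by rewrite /t; case: (leP (m + d / 2) ((m + 1) / 2)) => ?; split; lra.
pose dD z := (tau - f z * calH omega a z (W z)) - (sigma - f z * calH omega a z (V z)).
have dE z : m < z < t -> is_derive z 1 E (dD z + eps * (1 - 0)).
  move=> /andP[mz zt]; have z01 : 0 < z < 1 by apply/andP; split; lra.
  apply: is_deriveD; first by apply: is_deriveB; exact: calV_is_derive.
have cEmt : {within `[m, t], continuous E}.
  apply: continuous_subspaceW cE => z /=; rewrite !in_itv/= => /andP[? ?].
  by apply/andP; split; lra.
have dE' z : z \in `]m, t[ -> is_derive z 1 E (dD z + eps * (1 - 0)).
  by rewrite in_itv; exact: dE.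
have [c + EE] := MVT mt dE' cEmt.
rewrite in_itv/= => /andP[mc ct].
have c01 : 0 < c < 1 by apply/andP; split; lra.
have : E t <= E m by apply: maxE; rewrite in_itv/=; apply/andP; split; lra.
have Dc : 0 < D c by apply: Dd => /=; rewrite ltr_norml; apply/andP; split; lra.
(* Where [W > V], monotonicity of [calH] makes the derivative of [W - V] at least
   [tau - sigma >= 0], so the tilt contributes a slope of at least [eps]. *)
have Hc : calH omega a c (W c) <= calH omega a c (V c).
  by apply: calH_nincr; [exact: in01|exact: calV_gt0 hV c01|move: Dc; rewrite /D; lra].
have : 0 < (dD c + eps * (1 - 0)) * (t - m); last by lra.
rewrite mulr_gt0 ?subr_gt0// /dD; have := f_gt0 c01; nra.
Qed.

(** The solution at the minimal speed vanishes at 0 and dominates [V], because solutions decrease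
    with the speed. *)
Lemma calV0 sigma_s sigma V : is_sigma_s omega a f sigma_s -> sigma_s <= sigma ->
  is_calV omega a f sigma V -> V 0 = 0.
Proof.
move=> [[_ [W [hW W0]]] _] ss hV.
have [cV _ _] := hV; have [cW _ _] := hW.
have [_ V0 _] := (continuous_within_itvP _ ltr01).1 cV.
have {}W0 : W @ 0^'+ --> 0.
  by have [_ + _] := (continuous_within_itvP _ ltr01).1 cW; rewrite W0.
apply/le_anti/andP; split.
- apply: (ler_cvg_to V0 W0); near=> y; apply: (calV_le ss hW hV).
  by apply/andP; split; near: y; [exact: nbhs_right_gt|exact: nbhs_right_lt].
- apply: (cvgr_to_ge V0); near=> y; apply/ltW/(calV_gt0 hV).
  by apply/andP; split; near: y; [exact: nbhs_right_gt|exact: nbhs_right_lt].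
Unshelve. all: by end_near. Qed.

Let f_le : exists2 C, 0 <= C & forall y, 0 < y < 1 -> f y <= C * (1 - y).
Proof.
have [[cf [df [cdf dfP]]] _ f1 _] := hf.
have [M [_ /(_ (`|M| + 1))]] := compact_bounded (continuous_compact cdf
  (@segment_compact _ 0 1)).
rewrite (le_lt_trans (ler_norm _)) ?ltrDl// => /(_ isT) Mdf.
exists (`|M| + 1) => [|y /andP[y0 y1]]; first by rewrite addr_ge0.
have sub : `[y, 1] `<=` `[0, 1].
  by move=> z /=; rewrite !in_itv/= => /andP[? ->]; rewrite (le_trans (ltW y0)).
have dfP' z : z \in `]y, 1[ -> is_derive z 1 f (df z).
  by rewrite in_itv/= => /andP[yz z1]; apply: dfP; rewrite in_itv/= z1 (lt_trans y0).
have [c + fE] := MVT y1 dfP' (continuous_subspaceW sub cf).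
rewrite in_itv/= => /andP[yc c1].
have : `|df c| <= `|M| + 1.
  by apply: Mdf => /=; exists c => //; rewrite in_itv/=; apply/andP; split; lra.
rewrite ler_norml => /andP[? _]; move: fE; rewrite f1; nra.
Qed.

(** * Divergence of the primitive of H at both ends of the unit interval *)

Section calG.
Variables (sigma : R) (V G : R -> R).
Hypotheses (hV : is_calV omega a f sigma V) (V0 : V 0 = 0) (sigma_ge0 : 0 <= sigma)
  (G_derive : forall y, 0 < y < 1 -> is_derive y 1 G (calH omega a y (V y))).

Let G_continuous y : 0 < y < 1 -> {for y, continuous G}.
Proof.
by move=> y01; apply/differentiable_continuous/derivable1_diffP; have [] := G_derive y01.
Qed.

Let calV_cvg1 : V z @[z --> 1^'-] --> 0.
Proof.
by have [/(continuous_within_itvP _ ltr01)[_ _ ] + V1 _] := hV; rewrite V1.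
Qed.

Let calV_le_linear y : 0 < y < 1 -> V y <= sigma * y.
Proof.
move=> /andP[y0 y1]; have [cV _ _] := hV.
have : sigma * 0 - V 0 <= sigma * y - V y.
  apply: (@ge0_is_derive_le _ (fun z => sigma * z - V z)
    (fun z => sigma * 1 - (sigma - f z * calH omega a z (V z)))) => [|z /andP[z0 zy]||z
      /andP[z0 zy]].
  - exact: ltW.
  - by apply: is_deriveB; apply: (calV_is_derive hV); rewrite z0 (lt_trans zy).
  - have cL : {within `[0, y], continuous (fun z => sigma * z)}.
      by apply: continuous_subspaceT => z; apply: cvgM; [exact: cvg_cst|exact: cvg_id].
    have sub : `[0, y] `<=` `[0, 1].
      by move=> z /=; rewrite !in_itv/= => /andP[-> ?]; rewrite (le_trans _ (ltW y1)).
    by move=> z; apply: cvgB; [exact: cL|exact: (continuous_subspaceW sub cV)].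
  - have z01 : 0 < z < 1 by rewrite z0 (lt_trans zy).
    have := calH_ge0 (in01 z01) (calV_gt0 hV z01); have := f_gt0 z01; nra.
by rewrite V0 mulr0 subr0 subr_ge0.
Qed.

(** [V z <= sigma * z] turns the bound [m / V] into [(m / sigma) / z], whose primitive is
    logarithmic. Positivity of [V] at 1/2 gives [sigma > 0]. *)
Lemma calG_unbounded_below B : exists2 y, 0 < y < 1 & G y < B.
Proof.
have half01 : 0 < (2^-1 : R) < 1 by apply/andP; split; lra.
have sigma0 : 0 < sigma.
  by have := calV_le_linear half01; have := calV_gt0 hV half01; lra.
have [|m [d [m0 d0 Hd]]] := @calH_lower_bound 0; first by rewrite lexx ler01.
have [x [x0 xd xds x1]] := exists_between0 d0 (divr_gt0 d0 sigma0) ltr01.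
have zx01 z : 0 < z <= x -> 0 < z < 1 by move=> /andP[? ?]; apply/andP; split; lra.
have [|z zx|y /zx01 y01 GB] := @unbounded_below_log _ G (fun z => calH omega a z (V z)) x
  (m / sigma) x0 _ (fun z zx => G_derive (zx01 z zx)) _ B.
- by rewrite divr_gt0.
- have z01 := zx01 z zx; have /andP[z0 zx'] := zx.
  have Vz0 := calV_gt0 hV z01; have Vz := calV_le_linear z01.
  have szd : sigma * z < d by rewrite mulrC -ltr_pdivlMr//; lra.
  apply: le_trans (Hd z (V z) (in01 z01) _ _); last 2 first.
  + by rewrite subr0 gtr0_norm//; lra.
  + by apply/andP; split; lra.
  by rewrite -mulrA -invfM ler_pM2l// lef_pV2// posrE mulr_gt0.
- by exists y.
Qed.

Lemma calG_unbounded_above B : exists2 y, 0 < y < 1 & B < G y.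
Proof.
have [//|noy] := pselect (exists2 y, 0 < y < 1 & B < G y).
have GB y : 0 < y < 1 -> G y <= B.
  by move=> y01; rewrite leNgt; apply/negP => ?; apply: noy; exists y.
have [C C0 fC] := f_le.
have half01 : 0 < (2^-1 : R) < 1 by apply/andP; split; lra.
have G_nd x y : 0 < x -> x <= y -> y < 1 -> G x <= G y.
  move=> x0 xy y1; apply: (@ge0_is_derive_le _ G (fun z => calH omega a z (V z)) x y xy).
  - by move=> z /andP[? ?]; apply: G_derive; apply/andP; split; lra.
  - apply: continuous_in_subspaceT => z; rewrite inE/= in_itv/= => /andP[? ?].
    by apply: G_continuous; apply/andP; split; lra.
  - move=> z /andP[? ?]; have z01 : 0 < z < 1 by apply/andP; split; lra.
    by apply: calH_ge0; [exact: in01|exact: calV_gt0 hV z01].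
(* The summand 1 only ensures [K > 0], as [C] or [B - G 2^-1] may be 0. *)
pose K := C * (B - G 2^-1) + 1.
have K0 : 0 < K by have := GB _ half01; rewrite /K => ?; nra.
have VK y : 2^-1 <= y -> y < 1 -> V y <= K * (1 - y).
  move=> y2 y1; have y0 : 0 < y by lra.
  pose L := C * (1 - y); have L0 : 0 <= L by rewrite mulr_ge0// subr_ge0 ltW.
  (* [V - sigma t + L G] has derivative [(L - f) H >= 0] on [[y, 1[], because
     [f t <= C * (1 - t) <= L]. Letting z tend to 1 bounds [V y] by [L * (B - G y)]. *)
  have EE z : y < z < 1 -> V y - sigma * y + L * G y <= V z - sigma * z + L * B.
    move=> /andP[yz z1]; have z01 : 0 < z < 1 by apply/andP; split; lra.
    apply: (@le_trans _ _ (V z - sigma * z + L * G z)); last first.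
      by rewrite lerD2l ler_wpM2l// GB.
    have t01 t : y <= t <= z -> 0 < t < 1 by move=> /andP[? ?]; apply/andP; split; lra.
    pose E t := V t - sigma * t + L * G t.
    pose E' t := sigma - f t * calH omega a t (V t) - sigma * 1 +
      L * calH omega a t (V t).
    have dE t : y <= t <= z -> is_derive t 1 E (E' t).
      move=> /t01 tt; apply: is_deriveD.
        by apply: is_deriveB; exact: (calV_is_derive hV tt).
      by apply: is_deriveZ; exact: G_derive.
    apply: (@ge0_is_derive_le _ E E' y z (ltW yz)).
    - by move=> t /andP[? ?]; apply: dE; apply/andP; split; lra.
    - apply: continuous_in_subspaceT => t; rewrite inE/= in_itv/= => tt.
      by apply/differentiable_continuous/derivable1_diffP; have [] := dE t tt.
    - move=> t /andP[? ?]; have tt : 0 < t < 1 by apply: t01; apply/andP; split; lra.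
      have := calH_ge0 (in01 tt) (calV_gt0 hV tt); have := fC t tt; rewrite /E' /L => ? ?.
      have : C * (1 - t) <= C * (1 - y) by rewrite ler_wpM2l//; lra.
      by move=> ?; nra.
  have lim1 : V z - sigma * z + L * B @[z --> 1^'-] --> 0 - sigma * 1 + L * B.
    apply: cvgD; last exact: cvg_cst.
    apply: cvgB; first exact: calV_cvg1.
    by apply: cvgM; [exact: cvg_cst|apply: cvg_at_left_filter; exact: cvg_id].
  have : V y - sigma * y + L * G y <= 0 - sigma * 1 + L * B.
    apply: (cvgr_to_ge lim1); near=> z; apply: EE; apply/andP; split; near: z.
      exact: nbhs_left_gt.
    exact: nbhs_left_lt.
  have : G 2^-1 <= G y by apply: G_nd => //; lra.
  rewrite /K /L => ? ?.
  have : C * (1 - y) * G 2^-1 <= C * (1 - y) * G y by rewrite ler_wpM2l.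
  have : 0 <= sigma * (1 - y) by rewrite mulr_ge0//; lra.
  by move=> ? ?; lra.
have [|m [d [m0 d0 Hd]]] := @calH_lower_bound 1; first by rewrite lexx ler01.
have [x [x0 xd xdK x1]] := exists_between0 d0 (divr_gt0 d0 K0) (andP half01).1.
have zx01 z : 0 < z <= x -> 0 < 1 - z < 1 by move=> /andP[? ?]; apply/andP; split; lra.
(* Reflection moves the end point 1 to 0, where the logarithmic lemma applies. *)
have dG z : 0 < z <= x -> is_derive z 1 (fun z => - G (1 - z))
    (calH omega a (1 - z) (V (1 - z))).
  move=> /zx01 z01; rewrite -[X in is_derive _ _ _ X]opprK; apply: is_deriveN.
  have d1 : is_derive z 1 (fun z => 1 - z) (0 - 1) by apply: is_deriveB.
  rewrite -mulrN1 -[X in _ * X]sub0r.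
  exact: (@is_derive1_comp _ G _ z _ _ (G_derive z01) d1).
have [|z zx|y /zx01 y01 Gy] := @unbounded_below_log _ _ _ x (m / K) x0 _ dG _ (- B).
- by rewrite divr_gt0.
- have z01 := zx01 z zx; have /andP[z0 zx'] := zx.
  have Vz0 := calV_gt0 hV z01.
  have Vz : V (1 - z) <= K * z.
    have -> : K * z = K * (1 - (1 - z)) by congr (_ * _); ring.
    by apply: VK; lra.
  have Kzd : K * z < d by rewrite mulrC -ltr_pdivlMr//; lra.
  apply: le_trans (Hd (1 - z) (V (1 - z)) (in01 z01) _ _); last 2 first.
  + by rewrite addrAC subrr sub0r normrN gtr0_norm//; lra.
  + by apply/andP; split; lra.
  by rewrite -mulrA -invfM ler_pM2l// lef_pV2// posrE mulr_gt0.
- by exfalso; have := GB _ y01; lra.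
Unshelve. all: by end_near. Qed.

Lemma calG_surjective xi : exists2 y, 0 < y < 1 & G y = xi.
Proof.
have [x x01 Gx] := calG_unbounded_below xi.
have [y y01 Gy] := calG_unbounded_above xi.
have sub s t : 0 < s < 1 -> 0 < t < 1 -> forall z, s <= z <= t -> 0 < z < 1.
  by move=> /andP[? ?] /andP[? ?] z /andP[? ?]; apply/andP; split; lra.
have cG s t : 0 < s < 1 -> 0 < t < 1 -> {within `[s, t], continuous G}.
  move=> s01 t01; apply: continuous_in_subspaceT => z;
    rewrite inE/= in_itv/= => /(sub _ _ s01 t01).
  exact: G_continuous.
have [xy|/ltW yx] := leP x y.
- have [|c + Gc] := IVT xy (cG _ _ x01 y01) (v := xi).
    by case: (leP (G x) (G y)) => ?; apply/andP; split; lra.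
  by rewrite in_itv/= => /(sub _ _ x01 y01) c01; exists c.
- have [|c + Gc] := IVT yx (cG _ _ y01 x01) (v := xi).
    by case: (leP (G y) (G x)) => ?; apply/andP; split; lra.
  by rewrite in_itv/= => /(sub _ _ y01 x01) c01; exists c.
Qed.

End calG.
End affine_growth_flux.

Theorem theorem6p2 (R : realType) (omega : R -> \bar R) (a : R -> R -> R)
    (f : R -> R) (abar atilde sigma_s sigma u0 : R) (V : R -> R)
    (homega : flux_domain omega) (ha : flux omega a) (hf : reaction f)
    (haC1 : flux_C1 omega a)
    (has : forall u s, Omega omega (u, s) -> 0 < derive1 (a u) s)
    (haplus : {within `[0, 1], continuous (aplus omega a)})
    (habar : 0 < abar) (hatilde : 0 < atilde)
    (hgrowth : forall u s, Omega omega (u, s) ->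
       `|a u s| <= abar * `|s| + atilde)
    (hsigma_s : is_sigma_s omega a f sigma_s)
    (hsigma : sigma_s <= sigma) (hsigma_r : (sigma%:E <= sigma_r omega a f)%E)
    (hV : is_calV omega a f sigma V)
    (hu0 : 0 < u0 < 1)
    (hS0 : critical_levels omega a V u0 !=set0)
    (hSfin : finite_set (critical_levels omega a V u0)) :
  flux_saturated_profile omega a f sigma
    (profile omega a V u0) (critical_levels omega a V u0).
Proof.
have sigma_ge0 : 0 <= sigma by apply: le_trans hsigma; case: hsigma_s => -[].
have V0 : V 0 = 0 := calV0 homega ha haC1 habar hgrowth hf hsigma_s hsigma hV.
have dV y := @calV_is_derive _ _ _ _ _ _ y hV.
have V_gt0 y : 0 < y < 1 -> 0 < V y by have [_ _ +] := hV => /[apply] -[].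
have in01 (y : R) : 0 < y < 1 -> 0 <= y <= 1 by move=> /andP[/ltW -> /ltW ->].
have cV (y : R) : 0 < y < 1 -> {for y, continuous V}.
  by move=> y01; apply/differentiable_continuous/derivable1_diffP; have [] := dV y y01.
have cf (y : R) : 0 < y < 1 -> {for y, continuous f}.
  have [[_ [df [_ dfP]]] _ _ _] := hf => y01.
  by apply/differentiable_continuous/derivable1_diffP; have [|] := dfP y; rewrite ?in_itv.
pose p y := calH omega a y (V y); pose G := calG omega a V u0.
pose u := profile omega a V u0.
have p_ge0 (y : R) : 0 < y < 1 -> 0 <= p y.
  by move=> y01; apply: (calH_ge0 homega ha haC1 habar hgrowth);
    [exact: in01|exact: V_gt0].
have cp (y : R) : 0 < y < 1 -> {for y, continuous p}.
  by move=> y01; apply: (calH_continuous homega ha haC1 habar hgrowth y01 (cV y y01)).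
have dG (y : R) : 0 < y < 1 -> is_derive y 1 G (p y).
  exact: oriented_integral_is_derive.
have uP xi : 0 < u xi < 1 /\ G (u xi) = xi.
  apply: (@xgetPex _ 0 [set y | 0 < y < 1 /\ G y = xi]).
  have [y y01 Gy] := calG_surjective homega ha haC1 has habar hgrowth hf hV V0
    sigma_ge0 dG xi.
  by exists y.
have u01 xi : 0 < u xi < 1 := (uP xi).1.
have uK : cancel u G := fun xi => (uP xi).2.
(* The chosen point detects criticality: if [p (u xi)] is nonzero, the level set of xi is a
   singleton and contains no zero of [p]. *)
have critE : critical_levels omega a V u0 = [set xi | p (u xi) = 0].
  apply/seteqP; split => xi /=.
  - move=> [y [y01 Gy [_ Gy0]]].
    have py0 : p y = 0 by have [_ <-] := dG y y01.
    apply/eqP/negPn/negP => pu.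
    have yE := primitive_inj p_ge0 cp dG (u01 xi) y01 pu (etrans Gy (esym (uK xi))).
    by rewrite -yE py0 eqxx in pu.
  - by move=> pu; exists (u xi); split => //; rewrite -pu; exact: dG.
rewrite critE in hSfin *.
split => //.
- by move=> xi /eqP pxi; exact: (level_inverse_C1_at p_ge0 cp dG u01 uK).
- split.
  + by move=> xi; exact: in01.
  + exact: (level_inverse_bounded_variation p_ge0 dG u01 uK).
  exists (fun xi => (p (u xi))^-1); split.
  + exact: (level_inverse_ac_density p_ge0 cp dG u01 uK).
  + apply: aeW => xi; split => /=; first exact: in01.
    by rewrite (omega_pinfty homega ha habar hgrowth (in01 _ (u01 xi))) ltNye ltry.
  (* At a critical level the density is [0^-1 = 0] and the flux is [a u 0 = 0] instead of [V]; the
     factor [p y] hides this discrepancy. *)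
  pose W y := if p y == 0 then 0 else V y.
  have aW xi : a (u xi) (p (u xi))^-1 = W (u xi).
    rewrite /W; case: eqVneq => [->|pu].
      by rewrite invr0 (flux_at0 homega ha habar hgrowth)//; exact: in01.
    by apply: (a_calHV homega ha haC1 habar hgrowth) => //; [exact: in01|exact: V_gt0].
  have mu_u := level_inverse_measurable p_ge0 dG u01 uK.
  have mW : measurable_fun [set: R] (W \o u).
    rewrite (_ : W \o u = fun xi => if (p \_ `]0, 1[) (u xi) == 0 then 0
      else (V \_ `]0, 1[) (u xi)).
      apply: measurable_fun_ifT; last 2 first.
      - exact: measurable_cst.
      - exact: measurableT_comp (measurable_restrict_continuous cV) mu_u.
      apply: measurable_fun_eqr; last exact: measurable_cst.
      exact: measurableT_comp (measurable_restrict_continuous cp) mu_u.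
    by apply/funext => xi; rewrite /W /= !patchE !mem_setE /= in_itv/= u01.
  have mfu : measurable_fun [set: R] (f \o u).
    rewrite (_ : f \o u = (f \_ `]0, 1[) \o u).
      exact: measurableT_comp (measurable_restrict_continuous cf) mu_u.
    by apply/funext => xi; rewrite /= patchE mem_setE /= in_itv/= u01.
  move=> phi tphi.
  have pK (F : R -> R) (y : R) : 0 < y < 1 -> F (u (G y)) * p y = F y * p y.
    move=> y01; have [->|py] := eqVneq (p y) 0; first by rewrite !mulr0.
    by rewrite (primitiveK p_ge0 cp dG u01 uK).
  (* The reduced equation states exactly that [V - sigma y] has derivative [- f p], which vanishes
     together with [p]. *)
  apply: (level_inverse_weak_equation p_ge0 cp dG u01 uK
    (F := fun y => V y - sigma * y) (F' := fun y => - (f y * p y)) (b := f \o u)) => //.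
  + move=> y y01; rewrite (_ : - (f y * p y) = sigma - f y * p y - sigma * 1);
      last by ring.
    by apply: is_deriveB; exact: dV.
  + by move=> y y01; apply: cvgN; apply: cvgM; [exact: cf|exact: cp].
  + apply: measurable_funB; last exact: measurable_funM.
    by rewrite (_ : (fun xi => _) = W \o u)//; apply/funext.
  + move=> y y01; rewrite (pK (fun z => a z (p z)^-1 - sigma * z))//.
    have [->|py] := eqVneq (p y) 0; first by rewrite !mulr0.
    by rewrite (a_calHV homega ha haC1 habar hgrowth) ?in01 ?V_gt0.
  + by move=> y y01; rewrite opprK (pK f).
- by move=> xi pxi; exact: (level_inverse_saturated p_ge0 cp dG u01 uK).
Qed.
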